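(* Let $d\ge 1$ be an integer, let $u=3\cdot 2^d$, and let $H$ be an abelian $2$-group of order $2^{2d+2}$. Then the group $\mathbb{Z}_3^2\times H$ contains a non-naive Hadamard difference set of order $u^2$ if and only if $$8\le \exp H\le 2^{d+2}.$$
   Context: All groups are finite abelian, written additively; $\mathbb{Z}_n$ is the cyclic group of order $n$ and $\exp H$ is the exponent of $H$. For a subset $B$ of $G$ and a complex character $\chi$ of $G$, write $\chi(B)=\sum_{g\in B}\chi(g)$. A Hadamard difference set (HDS) of order $u^2$ in a group $G$ of order $4u^2$ is a $(v,k,\lambda)=(4u^2,\,2u^2-u,\,u^2-u)$ difference set in $G$, i.e. a subset $D\subseteq G$ with $|D|=2u^2-u$ such that every nonzero element of $G$ has exactly $u^2-u$ representations as a difference of two elements of $D$. Equivalently, $|D|=2u^2-u$ and $|\chi(D)|=u$ for every nontrivial character $\chi$ of $G$. A cyclotomic integer $\alpha$ with $|\alpha|^2=n^2$ ($n$ a positive integer) is naive if $\alpha=n\zeta$ for some root of unity $\zeta$. An HDS $D$ of order $u^2$ in $G$ is naive if $\chi(D)$ is naive (i.e. equal to $u$ times a root of unity) for every nontrivial character $\chi$ of $G$; otherwise it is non-naive. *)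

(* Defs.v *)
From mathcomp Require Import all_boot all_order all_algebra all_fingroup.
From mathcomp Require Import all_solvable all_field all_character.

Set Implicit Arguments.
Unset Strict Implicit.
Unset Printing Implicit Defensive.

Import GRing.Theory Num.Theory.

Local Open Scope ring_scope.

(* Groups are finGroupTypes, hence multiplicative: [x * y^-1] below is the
   difference x - y of additive notation. *)
Definition difference_set (gT : finGroupType) (v k lambda : nat)
    (D : {set gT}) : Prop :=
  [/\ #|[set: gT]| = v,
      #|D| = k
    & forall g : gT, (g != 1)%g ->
        #|[set p : gT * gT | [&& p.1 \in D, p.2 \in D & (p.1 * p.2^-1 == g)%g]]|
        = lambda].

(* The natural-number subtractions are not truncated, since u <= u ^ 2. *)
Definition HDS (gT : finGroupType) (u : nat) (D : {set gT}) : Prop :=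
  difference_set (4 * u ^ 2)%N (2 * u ^ 2 - u)%N (u ^ 2 - u)%N D.

Definition char_sum (gT : finGroupType) (chi : 'CF([set: gT])) (B : {set gT}) :
    algC :=
  \sum_(g in B) chi g.

Definition naive (n : nat) (alpha : algC) : Prop :=
  exists (m : nat) (zeta : algC),
    [/\ (0 < m)%N, zeta ^+ m = 1 & alpha = n%:R * zeta].

(* For an abelian group the homomorphisms to the nonzero complex numbers are the
   linear characters; their values are roots of unity, so algC suffices. *)
Definition naive_HDS (gT : finGroupType) (u : nat) (D : {set gT}) : Prop :=
  HDS u D /\
  forall chi : 'CF([set: gT]),
    chi \is a linear_char -> chi != 1 -> naive u (char_sum chi D).

Definition non_naive_HDS (gT : finGroupType) (u : nat) (D : {set gT}) : Prop :=
  HDS u D /\ ~ naive_HDS u D.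

(* Main.v *)
(** A +-1 function f on G is, up to sign, a Hadamard difference set exactly when
    its autocorrelation vanishes off the identity, that is |chi(f)| = 2u for all
    characters chi.

    Existence goes by induction on d.  If B has index 2 in the 2-group K and w is
    an involution of B, a perfect function on Z_3^2 x K is obtained by placing on
    the two cosets of B the lift of a perfect function on Z_3^2 x B/<w> and a
    function on Z_3^2 x B that is antisymmetric under w and perfect relative to
    <w>: the first sees only the characters trivial on w, the second only the
    others.  Relative functions are built in the same way from relative functions
    on B/<w> and B/<uw>, starting from the four lines of Z_3^2 over a Klein group.
    Characters of B/<w> extend to K, so non-naive values persist; the induction
    starts from an explicit function on Z_3^2 x Z_8 x Z_2.

    For the converse, write H = <h> x L with h of order exp H = 2^a.  In the ring
    generated by the values of the characters of Z_3^2 x <h> that are -1 on the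
    involution of <h>, the element 1 - chi(h) is a uniformizer at 2, and complex
    conjugation is the Frobenius map modulo it.  So |chi(D)|^2 = 9 * 4^d forces
    2^d to divide chi(D) in that ring; hence the numbers of elements of D in some
    two cosets of L differ by a nonzero multiple of 2^d, so 2^d <= |L|.
    If exp H <= 4, then chi(D) lies in Z[i, omega], where the elements of norm
    9 * 4^d are 3 * 2^d times a unit. *)

Require Import Defs.
From mathcomp Require Import all_boot all_order all_algebra all_fingroup.
From mathcomp Require Import all_solvable all_field all_character.
From mathcomp Require Import zify ring.

Set Implicit Arguments.
Unset Strict Implicit.
Unset Printing Implicit Defensive.

Import Order.TTheory GRing.Theory Num.Theory.
Local Open Scope ring_scope.

(** * Correlation of functions on a product *)

Section Correlation.

Variables (zT gT : finGroupType).
Implicit Types (K B W : {group gT}) (f h : zT -> gT -> int).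

(* Functions on zT x K are curried: zT stays fixed while K is replaced by
   subgroups and quotients. *)
Definition corr (K : {set gT}) f h (a : zT) (t : gT) : int :=
  \sum_(z : zT) \sum_(x in K) f z x * h (z * a)%g (x * t)%g.

Definition perfect (K : {set gT}) f : Prop :=
  (forall z x, x \in K -> f z x ^+ 2 = 1) /\
  forall a t, t \in K ->
    corr K f f a t = (#|zT| * #|K|)%:R * ((a == 1%g) && (t == 1%g))%:R.

(** On the Fourier side: character sums vanish at characters trivial on [u] and have squared modulus
    2 * #|zT| * #|K| at those that are -1 on [u]. The factor 2 is what gluing into a group twice as
    large requires. *)
Definition rel_perfect (K : {set gT}) (u : gT) f : Prop :=
  [/\ forall z x, x \in K -> f z x ^+ 2 = 1,
      forall z x, x \in K -> f z (x * u)%g = - f z x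
    & forall a t, t \in K ->
        corr K f f a t = (#|zT| * #|K|)%:R *
                         ((a == 1%g)%:R * ((t == 1%g)%:R - (t == u)%:R))].

(** A character of [K] as a total function on [gT], convenient for composing with [coset W] and for
    extending to larger groups. The value at 1 excludes the zero function. *)
Definition char_on (K : {set gT}) (phi : gT -> algC) : Prop :=
  phi 1%g = 1 /\ {in K &, {morph phi : x y / (x * y)%g >-> x * y}}.

Definition fourier (K : {set gT}) (psi : zT -> algC) (phi : gT -> algC) f : algC :=
  \sum_(z : zT) \sum_(x in K) psi z * phi x * (f z x)%:~R.

(** Translating the summation variable by [w] changes the sign of exactly one of the two factors, so
    the correlation equals its own opposite. *)
Lemma corr_eq0 K f h w (e : bool) a t :
  abelian K -> w \in K -> t \in K ->
  (forall z x, x \in K -> f z (x * w)%g = (-1) ^+ e * f z x) ->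
  (forall z x, x \in K -> h z (x * w)%g = (-1) ^+ (~~ e) * h z x) ->
  corr K f h a t = 0.
Proof.
move=> abK Kw Kt fw hw; suff: corr K f h a t = - corr K f h a t by lia.
rewrite /corr -sumrN; apply: eq_bigr => z _; rewrite -sumrN.
rewrite (reindex_inj (mulIg w)) /=.
rewrite (eq_bigl (mem K)); last by move=> x; rewrite /= groupMr.
apply: eq_bigr => x Kx; rewrite fw // -mulgA.
have -> : (w * t = t * w)%g by apply: (centsP abK).
rewrite mulgA hw ?groupM //; case: {fw hw} e; rewrite /= expr0 expr1; ring.
Qed.

Lemma sum_index2 (V : nmodType) K B g (F : gT -> V) :
  B \subset K -> #|K : B|%g = 2%N -> g \in K -> g \notin B ->
  \sum_(x in K) F x = \sum_(x in B) F x + \sum_(x in B) F (g * x)%g.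
Proof.
move=> sBK iBK Kg nBg; rewrite (big_setID B) /= (setIidPr sBK); congr (_ + _).
have -> : K :\: B = (g *: B)%g.
  have nBK : (B <| K)%g by rewrite index2_normal.
  apply/eqP; rewrite eq_sym eqEcard; apply/andP; split.
    apply/subsetP=> _ /lcosetP[b Bb ->].
    by rewrite inE groupMr // nBg groupM // (subsetP sBK).
  have := Lagrange sBK; have := cardsID B K.
  rewrite (setIidPr sBK) iBK card_lcoset => <- /eqP.
  by rewrite muln2 -addnn eqn_add2l => /eqP <-.
rewrite -lcosetE /lcoset big_imset /=; last by move=> x y _ _ /mulgI.
by [].
Qed.

Definition glue (B : {set gT}) (g : gT) f1 f2 : zT -> gT -> int :=
  fun z x => if x \in B then f1 z x else f2 z (g^-1 * x)%g.

Section Index2.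

Variables (K B : {group gT}) (g : gT).
Hypotheses (abK : abelian K) (sBK : B \subset K) (iBK : #|K : B|%g = 2%N).
Hypotheses (Kg : g \in K) (nBg : g \notin B).

Lemma index2_mul x y : x \in K -> y \in K -> x \notin B ->
  (x * y \in B)%g = (y \notin B).
Proof.
move=> Kx Ky nBx; apply/idP/idP=> [Bxy | nBy].
  by apply: contra nBx => By; rewrite -(groupMr _ By).
have Bc z : z \in K -> z \notin B -> exists2 b, b \in B & z = (g * b)%g.
  (* Sum the indicator of [z] over the two cosets: the part over [B] vanishes, so the part over
     [g * B] is 1 and [z] lies there. *)
  move=> Kz nBz; have := sum_index2 (fun v => (v == z) : nat) sBK iBK Kg nBg.
  rewrite (bigD1 z) //= eqxx big1 => [|v /andP[_ /negPf->] //].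
  rewrite [X in _ = X + _]big1 => [|v Bv]; last first.
    by apply/eqP; rewrite eqb0; apply: contraNneq nBz => <-.
  rewrite add0r => /eqP; rewrite eq_sym; case: (pickP (fun b => (b \in B) && (g * b == z)%g)).
    by move=> b /andP[Bb /eqP <-]; exists b.
  move=> none; rewrite big1 // => b Bb; have := none b; by rewrite /= Bb => /= ->.
have [b Bb Dx] := Bc x Kx nBx; have [c Bcc Dy] := Bc y Ky nBy.
have Bgg : (g * g \in B)%g.
  have [//|nBgg] := boolP (g * g \in B)%g.
  have [v Bv /mulgI gv] := Bc _ (groupM Kg Kg) nBgg.
  by case/negP: nBg; rewrite gv.
rewrite Dx Dy -mulgA (mulgA b).
have -> : (b * g = g * b)%g by apply: (centsP abK); rewrite // (subsetP sBK).
by rewrite mulgA mulgA groupMr // groupMr.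
Qed.

Lemma index2_quo x : x \in K -> x \notin B -> (g^-1 * x \in B)%g.
Proof. by move=> Kx nBx; rewrite index2_mul ?groupV. Qed.

(** A shift in [B] preserves both cosets and gives the two autocorrelations. A shift outside [B]
    swaps the cosets, so only cross-correlations appear. *)
Lemma corr_glue f1 f2 a t :
  (forall a s, s \in B -> corr B f1 f2 a s = 0) ->
  (forall a s, s \in B -> corr B f2 f1 a s = 0) -> t \in K ->
  corr K (glue B g f1 f2) (glue B g f1 f2) a t =
  if t \in B then corr B f1 f1 a t + corr B f2 f2 a t else 0.
Proof.
move=> c12 c21 Kt; rewrite /corr.
under eq_bigr => z _ do rewrite (sum_index2 _ sBK iBK Kg nBg).
rewrite big_split /=; case: ifP => Bt.
  congr (_ + _); apply: eq_bigr => z _; apply: eq_bigr => x Bx; rewrite /glue.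
    by rewrite Bx groupM.
  rewrite !groupMr // !(negPf nBg) mulKg.
  by rewrite -mulgA mulKg.
have nBt : t \notin B by rewrite Bt.
have Bgt := index2_quo Kt nBt.
have Bgt' : (g * t \in B)%g by rewrite index2_mul.
transitivity (corr B f1 f2 a (g^-1 * t)%g + corr B f2 f1 a (g * t)%g).
  rewrite /corr.
congr (_ + _); apply: eq_bigr => z _; apply: eq_bigr => x Bx; rewrite /glue.
  have Kx := subsetP sBK x Bx.
  rewrite Bx groupMl // Bt mulgA; congr (_ * f2 _ _); rewrite !mulgA; congr (_ * _)%g.
  by apply: (centsP abK); rewrite ?groupV.
have Kx := subsetP sBK x Bx.
rewrite groupMr // (negPf nBg) mulKg -mulgA.
have Kxt := groupM Kx Kt; rewrite index2_mul // groupMl // nBt; congr (_ * f1 _ _).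
by rewrite !mulgA; congr (_ * _)%g; apply: (centsP abK).
by rewrite c12 // c21 // addr0.
Qed.

Lemma glue_sq f1 f2 :
  (forall z x, x \in B -> f1 z x ^+ 2 = 1) ->
  (forall z x, x \in B -> f2 z x ^+ 2 = 1) ->
  forall z x, x \in K -> glue B g f1 f2 z x ^+ 2 = 1.
Proof.
move=> sq1 sq2 z x Kx; rewrite /glue; case: ifPn => Bx; first exact: sq1.
by apply: sq2; apply: index2_quo.
Qed.

Lemma fourier_glue psi phi f1 f2 : char_on K phi ->
  fourier K psi phi (glue B g f1 f2) =
  fourier B psi phi f1 + phi g * fourier B psi phi f2.
Proof.
case=> _ phiM; rewrite /fourier.
under eq_bigr => z _ do rewrite (sum_index2 _ sBK iBK Kg nBg).
rewrite big_split /=; congr (_ + _).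
  by apply: eq_bigr => z _; apply: eq_bigr => x Bx; rewrite /glue Bx.
rewrite mulr_sumr; apply: eq_bigr => z _; rewrite mulr_sumr; apply: eq_bigr => x Bx.
have Kx := subsetP sBK x Bx.
by rewrite /glue groupMr // (negPf nBg) mulKg phiM //=; ring.
Qed.

(** The only constraint on the value at [g] is that its square be [phi (g * g)]; a complex square
    root exists. *)
Lemma char_on_extend phi : char_on B phi ->
  exists phi', char_on K phi' /\ {in B, phi' =1 phi}.
Proof.
case=> phi1 phiM; set s := sqrtC (phi (g * g)%g).
have Bgg : (g * g \in B)%g by rewrite index2_mul.
exists (fun x => if x \in B then phi x else s * phi (g^-1 * x)%g).
split; last by move=> x /= ->.
split=> [|x y Kx Ky /=]; first by rewrite group1.
have [Bx|nBx] := boolP (x \in B); have [By|nBy] := boolP (y \in B).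
- by rewrite groupM // phiM.
- rewrite groupMl // (negPf nBy).
  have -> : (g^-1 * (x * y) = x * (g^-1 * y))%g.
    by rewrite !mulgA; congr (_ * _)%g; apply: (centsP abK); rewrite ?groupV.
  by rewrite phiM ?index2_quo //=; ring.
- by rewrite groupMr // (negPf nBx) mulgA phiM ?index2_quo //=; ring.
- rewrite index2_mul // nBy mulrACA -expr2 sqrtCK.
  have Bgx := index2_quo Kx nBx; have Bgy := index2_quo Ky nBy.
  rewrite -(phiM _ _ Bgx Bgy) -(phiM _ _ Bgg (groupM Bgx Bgy)); congr phi.
  have -> : (g^-1 * x * (g^-1 * y) = g^-1 * g^-1 * (x * y))%g.
    rewrite -!mulgA; congr (_ * _)%g; rewrite !mulgA; congr (_ * _)%g.
    by apply: (centsP abK); rewrite ?groupV.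
  by rewrite -(mulgA g^-1 g^-1)%g -(mulgA g g)%g !mulKVg.
Qed.

End Index2.

End Correlation.

(** * Pulling functions back along a quotient *)

Section Lift.

Variables (zT gT : finGroupType) (B W : {group gT}).
Hypotheses (abB : abelian B) (sWB : W \subset B).

Definition lift (f : zT -> coset_of W -> int) : zT -> gT -> int :=
  fun z x => f z (coset W x).

Let nWB : B \subset 'N(W)%g.
Proof. exact: subset_trans (sub_abelian_cent abB sWB) (cent_sub _). Qed.

Lemma sum_lift (V : nmodType) (F : coset_of W -> V) :
  \sum_(x in B) F (coset W x) = (\sum_(y in (B / W)%g) F y) *+ #|W|.
Proof.
rewrite (partition_big (coset W) (mem (B / W)%g)) /=; last first.
  by move=> x Bx; rewrite mem_quotient.
rewrite -sumrMnl; apply: eq_bigr => y /morphimP[x Nx Bx Dy].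
rewrite (eq_bigr (fun=> F y)); last by move=> v /andP[_ /eqP->].
rewrite big_const iter_addr_0 -(card_rcoset W x).
congr (_ *+ _); apply: eq_card => v.
apply/andP/idP=> [[Bv /eqP cv]|Wxv].
  by apply/rcoset_kercosetP; rewrite ?(subsetP nWB) // cv Dy.
have Bv : v \in B.
  by case/rcosetP: Wxv => w Ww ->; rewrite groupM // (subsetP sWB).
split=> //; rewrite Dy; apply/eqP/rcoset_kercosetP => //.
exact: (subsetP nWB).
Qed.

Lemma corr_lift (f h : zT -> coset_of W -> int) a t : t \in B ->
  corr B (lift f) (lift h) a t = #|W|%:R * corr (B / W)%g f h a (coset W t).
Proof.
move=> Bt; rewrite /corr mulr_sumr; apply: eq_bigr => z _.
rewrite mulr_natl -(sum_lift (fun y => f z y * h (z * a)%g (y * coset W t)%g)).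
by apply: eq_bigr => x Bx; rewrite /lift morphM ?(subsetP nWB).
Qed.

Lemma fourier_lift psi phi (f : zT -> coset_of W -> int) :
  fourier B psi (phi \o coset W) (lift f) =
  #|W|%:R * fourier (B / W)%g psi phi f.
Proof.
rewrite /fourier mulr_sumr; apply: eq_bigr => z _.
by rewrite mulr_natl -(sum_lift (fun y => psi z * phi y * (f z y)%:~R)).
Qed.

Lemma char_on_lift phi : char_on (B / W)%g phi -> char_on B (phi \o coset W).
Proof.
case=> phi1 phiM; split=> [|x y Bx By /=]; first by rewrite /= morph1.
by rewrite morphM ?(subsetP nWB) //= phiM ?mem_quotient.
Qed.

Lemma coset_eqE x y : x \in B -> y \in B ->
  (coset W x == coset W y) = (x * y^-1 \in W)%g.
Proof.
move=> Bx By; rewrite -mem_rcoset.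
by apply/eqP/rcoset_kercosetP; rewrite ?(subsetP nWB).
Qed.

Lemma coset_eq1E x : x \in B -> (coset W x == 1%g) = (x \in W).
Proof.
move=> Bx; apply/eqP/idP=> [|Wx]; last exact: coset_id.
by apply: coset_idr; rewrite (subsetP nWB).
Qed.

End Lift.

Lemma mem_cycle2 (gT : finGroupType) (w x : gT) : #[w]%g = 2%N ->
  (x \in <[w]>%g) = (x == 1%g) || (x == w).
Proof.
move=> ow; apply/idP/orP=> [|[]/eqP->]; rewrite ?group1 ?cycle_id //.
case/cyclePmin=> i; rewrite ow => lti ->.
by case: i lti => [|[|]] //; rewrite ?expg0 ?expg1 eqxx; [left | right].
Qed.

(** * The two inductive constructions: gluing functions on the cosets of an index 2 subgroup *)

Section Steps.

Variables (zT gT : finGroupType) (K B : {group gT}) (g : gT).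
Hypotheses (abK : abelian K) (sBK : B \subset K) (iBK : #|K : B|%g = 2%N).
Hypotheses (Kg : g \in K) (nBg : g \notin B).

Let abB : abelian B. Proof. exact: abelianS sBK abK. Qed.

Let cardK : #|K| = (2 * #|B|)%N.
Proof. by rewrite -(Lagrange sBK) iBK mulnC. Qed.

Let sWB w : w \in B -> <[w]>%g \subset B. Proof. by rewrite cycle_subG. Qed.

Let card_quo2 w : w \in B -> #[w]%g = 2%N -> (2 * #|(B / <[w]>)%g|)%N = #|B|.
Proof.
move=> Bw ow; rewrite card_quotient; last first.
  exact: subset_trans (sub_abelian_cent abB (sWB Bw)) (cent_sub _).
by rewrite -(Lagrange (sWB Bw)) -orderE ow.
Qed.

(** The lift spreads each peak over a fibre of [coset <[w]>]: the positive peak lies over 1 and [w],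
    the negative one over [u] and [u * w]. *)
Let corr_lift_rel (w u : gT) (f : zT -> coset_of <[w]> -> int) a t :
  w \in B -> u \in B -> t \in B -> #[w]%g = 2%N -> u != 1%g -> u != w ->
  rel_perfect (B / <[w]>)%g (coset <[w]> u) f ->
  corr B (lift f) (lift f) a t = (#|zT| * #|B|)%:R * ((a == 1%g)%:R *
    ((t == 1%g)%:R + (t == w)%:R - (t == u)%:R - (t == u * w)%g%:R)).
Proof.
move=> Bw Bu Bt ow nu1 nuw [_ _ corrf].
rewrite (corr_lift abB (sWB Bw)) // corrf ?mem_quotient //.
rewrite -(card_quo2 Bw ow) -orderE ow.
rewrite (coset_eq1E abB (sWB Bw)) // (coset_eqE abB (sWB Bw)) // !mem_cycle2 //.
have -> : (t * u^-1 == 1)%g = (t == u) by rewrite -eq_mulgV1.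
have -> : (t * u^-1 == w)%g = (t == u * w)%g.
  rewrite -(inj_eq (mulIg u)) mulgKV.
  by have -> : (w * u = u * w)%g by apply: (centsP abB).
have w1 : w != 1%g by rewrite -order_eq1 ow.
have dis (p q : gT) : p != q -> ((t == p) || (t == q))%:R = (t == p)%:R + (t == q)%:R :> int.
  by move=> npq; case: eqP => [->|_]; rewrite ?(negPf npq) ?addr0 ?add0r.
rewrite !dis; first by ring.
  by rewrite -{1}[u]mulg1 (inj_eq (mulgI u)) eq_sym.
by rewrite eq_sym.
Qed.

(* The lift from B / <w> sees the characters that are -1 on u and 1 on w, the
   lift from B / <u * w> those that are -1 on both. *)
Lemma rel_perfect_step (u w : gT)
    (f1 : zT -> coset_of <[w]> -> int) (f2 : zT -> coset_of <[u * w]> -> int) :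
  u \in B -> w \in B -> #[u]%g = 2%N -> #[w]%g = 2%N -> u != w ->
  rel_perfect (B / <[w]>)%g (coset <[w]> u) f1 ->
  rel_perfect (B / <[u * w]>)%g (coset <[u * w]> u) f2 ->
  exists f : zT -> gT -> int, rel_perfect K u f.
Proof.
move=> Bu Bw ou ow nuw rel1 rel2.
have Buw : (u * w \in B)%g by rewrite groupM.
have uu : (u * u = 1)%g by rewrite -expg2 -ou expg_order.
have ww : (w * w = 1)%g by rewrite -expg2 -ow expg_order.
have cuw : (u * w = w * u)%g by apply: (centsP abB).
have u1 : u != 1%g by rewrite -order_eq1 ou.
have w1 : w != 1%g by rewrite -order_eq1 ow.
have nuuw : u != (u * w)%g by rewrite -{1}[u]mulg1 (inj_eq (mulgI u)) eq_sym.
have ouw : #[(u * w)%g]%g = 2%N.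
  apply: nt_prime_order => //; first by rewrite expg2 {2}cuw mulgA -(mulgA u) ww mulg1.
  apply: contra nuw => /eqP uw1; apply/eqP.
  by rewrite -[u]mulg1 -ww mulgA uw1 mul1g.
have sq1 z x : x \in B -> lift f1 z x ^+ 2 = 1.
  by case: rel1 => sq _ _ Bx; apply: sq; rewrite mem_quotient.
have sq2 z x : x \in B -> lift f2 z x ^+ 2 = 1.
  by case: rel2 => sq _ _ Bx; apply: sq; rewrite mem_quotient.
have cosM v x y : v \in B -> x \in B -> y \in B ->
    coset <[v]> (x * y)%g = (coset <[v]> x * coset <[v]> y)%g.
  move=> Bv Bx By; have nW := subset_trans (sub_abelian_cent abB (sWB Bv)) (cent_sub _).
  by rewrite morphM // (subsetP nW).
have anti1 z x : x \in B -> lift f1 z (x * u)%g = - lift f1 z x.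
  by case: rel1 => _ anti _ Bx; rewrite /lift cosM // anti // mem_quotient.
have anti2 z x : x \in B -> lift f2 z (x * u)%g = - lift f2 z x.
  by case: rel2 => _ anti _ Bx; rewrite /lift cosM // anti // mem_quotient.
have inv1 z x : x \in B -> lift f1 z (x * w)%g = lift f1 z x.
  by move=> Bx; rewrite /lift coset_kerr // cycle_id.
(* [lift f2] is invariant under [u * w] and antisymmetric under [u]. The two lifts thus have
   opposite parities under [w], and [corr_eq0] kills their cross-correlations. *)
have inv2 z x : x \in B -> lift f2 z (x * w)%g = - lift f2 z x.
  move=> Bx; have -> : (x * w = x * u * (u * w))%g.
    by rewrite -!mulgA (mulgA u u) uu mul1g.
  have -> : lift f2 z (x * u * (u * w))%g = lift f2 z (x * u)%g.
    by rewrite /lift coset_kerr // cycle_id.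
  exact: anti2.
exists (glue B g (lift f1) (lift f2)); split.
- exact: (glue_sq abK sBK iBK Kg nBg).
- move=> z x Kx; rewrite /glue groupMr //.
  case: ifPn => Bx; first exact: anti1.
  by rewrite mulgA; apply/anti2/(index2_quo abK sBK iBK Kg nBg).
move=> a t Kt; rewrite (corr_glue abK sBK iBK Kg nBg) //; first last.
- move=> b s Bs; apply: (@corr_eq0 _ _ _ _ _ w true) => // z x Bx.
    by rewrite inv2 // expr1 mulN1r.
  by rewrite inv1 // mul1r.
- move=> b s Bs; apply: (@corr_eq0 _ _ _ _ _ w false) => // z x Bx.
    by rewrite inv1 // mul1r.
  by rewrite inv2 // expr1 mulN1r.
case: ifPn => Bt; last first.
  have -> : t == 1%g = false by apply: contraNF Bt => /eqP->.
  have -> : t == u = false by apply: contraNF Bt => /eqP->.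
  by rewrite subrr !mulr0.
(* In the sum of the two autocorrelations the peaks at [w] and [u * w] cancel, and those at 1 and
   [u] double. *)
rewrite (corr_lift_rel _ Bw Bu) // (corr_lift_rel _ Buw Bu) //.
by rewrite (mulgA u u) uu mul1g cardK !natrM; ring.
Qed.

(** The lift of [f1] has peaks at 1 and [w], the relative function opposite ones at 1 and [w], so
    only 1 survives in the sum. The extended character is trivial on [w]: it annihilates [f2], and
    it sees [f1] multiplied by the fibre size 2. *)
Lemma perfect_step (w : gT) (f1 : zT -> coset_of <[w]> -> int)
    (f2 : zT -> gT -> int) psi beta phi :
  w \in B -> #[w]%g = 2%N ->
  perfect (B / <[w]>)%g f1 -> rel_perfect B w f2 ->
  char_on (B / <[w]>)%g phi ->
  fourier (B / <[w]>)%g psi phi f1 = beta ->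
  exists (f : zT -> gT -> int) phi',
    [/\ perfect K f, char_on K phi' & fourier K psi phi' f = 2%:R * beta].
Proof.
move=> Bw ow [sqf1 corrf1] [sq2 anti2 corr2] phi_ch fou.
have w1 : w != 1%g by rewrite -order_eq1 ow.
have ww : (w * w = 1)%g by rewrite -expg2 -ow expg_order.
have sq1 z x : x \in B -> lift f1 z x ^+ 2 = 1.
  by move=> Bx; apply: sqf1; rewrite mem_quotient.
have inv1 z x : x \in B -> lift f1 z (x * w)%g = lift f1 z x.
  by move=> Bx; rewrite /lift coset_kerr // cycle_id.
have phiB := char_on_lift abB (sWB Bw) phi_ch.
have [phi' [phi'K phi'B]] := char_on_extend abK sBK iBK Kg nBg phiB.
exists (glue B g (lift f1) f2), phi'; split=> //; last first.
  rewrite (fourier_glue sBK iBK Kg nBg _ _ _ phi'K).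
  have -> : fourier B psi phi' (lift f1) = 2%:R * beta.
    rewrite -fou -[in RHS]ow -(fourier_lift abB (sWB Bw)) /fourier.
    by apply: eq_bigr => z _; apply: eq_bigr => x Bx; rewrite phi'B.
  have -> : fourier B psi phi' f2 = 0.
    suff: fourier B psi phi' f2 = - fourier B psi phi' f2.
      by move/eqP; rewrite -subr_eq0 opprK -mulr2n mulrn_eq0 /= => /eqP.
    rewrite {1}/fourier -sumrN; apply: eq_bigr => z _; rewrite -sumrN.
    rewrite (reindex_inj (mulIg w)) /=.
    rewrite (eq_bigl (mem B)); last by move=> x; rewrite /= groupMr.
    apply: eq_bigr => x Bx; rewrite anti2 // !phi'B ?groupM //=.
    by rewrite coset_kerr ?cycle_id // rmorphN mulrN.
  by rewrite mulr0 addr0.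
split; first exact: (glue_sq abK sBK iBK Kg nBg).
move=> a t Kt; rewrite (corr_glue abK sBK iBK Kg nBg) //; first last.
- move=> b s Bs; apply: (@corr_eq0 _ _ _ _ _ w true) => // z x Bx.
    by rewrite anti2 // expr1 mulN1r.
  by rewrite inv1 // mul1r.
- move=> b s Bs; apply: (@corr_eq0 _ _ _ _ _ w false) => // z x Bx.
    by rewrite inv1 // mul1r.
  by rewrite anti2 // expr1 mulN1r.
case: ifPn => Bt; last first.
  have -> : t == 1%g = false by apply: contraNF Bt => /eqP->.
  by rewrite andbF mulr0.
rewrite corr2 // (corr_lift abB (sWB Bw)) // corrf1 ?mem_quotient //.
rewrite cardK -(card_quo2 Bw ow) -orderE ow.
rewrite (coset_eq1E abB (sWB Bw)) // mem_cycle2 //.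
have andR (p q : bool) : (p && q)%:R = p%:R * q%:R :> int by case: p q => [] [].
rewrite !andR; have -> : ((t == 1%g) || (t == w))%:R = (t == 1%g)%:R + (t == w)%:R :> int.
  by case: eqP => [->|_]; rewrite ?add0r // eq_sym (negPf w1) addr0.
by rewrite !natrM; ring.
Qed.

End Steps.

(** * Abelian 2-groups *)

Section AbelianTwoGroups.

Local Open Scope group_scope.
Variable gT : finGroupType.
Implicit Types (K B A : {group gT}) (x u v w : gT).

Lemma cycle_involution_uniq x u v :
  u \in <[x]> -> v \in <[x]> -> #[u] = 2%N -> #[v] = 2%N -> u = v.
Proof.
move=> xu xv ou ov; have: <[u]> :==: <[v]>.
  by rewrite (eq_subG_cyclic (cycle_cyclic x)) ?cycle_subG // -!orderE ou ov.
move/eqP=> uv; have := cycle_id u; rewrite uv mem_cycle2 //.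
by case/orP=> /eqP // u1; rewrite u1 order1 in ou.
Qed.

(** Otherwise [B] has at most one involution, since [<[x]>] has at most one. Then [B] has rank at
    most 1, hence is cyclic, and its exponent would be its order 2^n. *)
Lemma involution_outside_cycle B x j n : abelian B -> #|B| = (2 ^ n)%N ->
  (j < n)%N -> {in B, forall y, y ^+ (2 ^ j) = 1} ->
  exists w, [/\ w \in B, #[w] = 2%N & w \notin <[x]>].
Proof.
move=> abB cardB ltjn expB.
have pB : 2.-group B by rewrite /pgroup cardB pnatX pnat_id ?orbT.
have [/existsP[w /and3P[Bw /eqP ow nxw]]|/existsPn none] :=
  boolP [exists w, [&& w \in B, #[w] == 2%N & w \notin <[x]>]]; first by exists w.
have inx w : w \in B -> #[w] = 2%N -> w \in <[x]>.
  by move=> Bw ow; move: (none w); rewrite Bw ow eqxx /= negbK.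
suff /cyclicP[y defB] : cyclic B.
  have := expB y; rewrite defB cycle_id => /(_ isT)/eqP.
  rewrite -order_dvdn orderE -defB cardB => /dvdn_leq; rewrite expn_gt0 => /(_ isT).
  by rewrite leq_exp2l // leqNgt ltjn.
rewrite abelian_rank1_cyclic // (rank_pgroup pB) p_rank_abelian //.
have OhmE : 'Ohm_1(B) = 'Ldiv_2(B).
  by rewrite (OhmEabelian pB) ?expn1 // (abelianS (Ohm_sub _ _)).
have leO : (#|'Ohm_1(B)| <= 2)%N.
  have [/existsP[w /andP[/LdivP[Bw w2] nw1]] | /existsPn O1] :=
    boolP [exists w, (w \in 'Ldiv_2(B)) && (w != 1)]; last first.
    rewrite OhmE; apply: (@leq_trans #|[set 1 : gT]|); last by rewrite cards1.
    apply: subset_leq_card.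
    apply/subsetP=> v Ov; rewrite inE; have := O1 v.
    by rewrite Ov negbK.
  have ow := nt_prime_order (isT : prime 2) w2 nw1.
  rewrite OhmE; apply: (@leq_trans #|[set 1; w]|); last by rewrite cards2; case: (_ != _).
  apply: subset_leq_card.
  apply/subsetP=> v /LdivP[Bv v2]; rewrite !inE.
  have [//|nv1 /=] := eqVneq v 1; apply/eqP.
  have ov := nt_prime_order (isT : prime 2) v2 nv1.
  by apply: (@cycle_involution_uniq x); rewrite ?inx.
by rewrite -(@leq_exp2l 2) // (leq_trans _ leO) // dvdn_leq ?cardG_gt0 // pfactor_dvdnn.
Qed.

(** The order of [K] leaves no room for two cyclic subgroups of order 2^(m+1) with trivial
    intersection. So all elements of that order have the same 2^m-th power, and the elements killed
    by 2^m form a subgroup of index 2. If no element has that order, any maximal subgroup containing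
    [A] works. *)
Lemma index2_low_exponent K A m n : abelian K -> #|K| = (2 ^ n)%N ->
    (n < 2 * m.+1)%N -> {in K, forall x, x ^+ (2 ^ m.+1) = 1} ->
    A \subset K -> A :!=: K -> {in A, forall x, x ^+ (2 ^ m) = 1} ->
  exists B, [/\ A \subset B, B \subset K, #|K : B| = 2%N
              & {in B, forall x, x ^+ (2 ^ m) = 1}].
Proof.
move=> abK cardK ltnm expK sAK neAK expA.
have pK : 2.-group K by rewrite /pgroup cardK pnatX pnat_id ?orbT.
have [/existsP[x0 /andP[Kx0 nx0]]|/existsPn none] :=
  boolP [exists x, (x \in K) && (x ^+ (2 ^ m) != 1)]; last first.
  have [eqAK|[M maxM sAM]] := maximal_exists sAK; first by rewrite eqAK eqxx in neAK.
  have sMK : M \subset K by apply: proper_sub (maxgroupp maxM).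
  exists M; split=> //; first exact: p_maximal_index pK maxM.
  move=> x Mx; apply/eqP; move: (none x).
  by rewrite (subsetP sMK) //= negbK.
have gT2 : group_set 'Ldiv_(2 ^ m)(K) by rewrite group_Ldiv.
pose T := Group gT2.
have TP x : (x \in T) = (x \in K) && (x ^+ (2 ^ m) == 1) by rewrite !inE.
have sTK : T \subset K by apply/subsetP=> x; rewrite TP => /andP[].
have ord x : x \in K -> x ^+ (2 ^ m) != 1 -> #[x] = (2 ^ m.+1)%N.
  move=> Kx nx; have : (#[x] %| 2 ^ m.+1)%N by rewrite order_dvdn expK.
  case/(dvdn_pfactor _ _ (isT : prime 2)) => i lei oi; rewrite oi.
  congr (_ ^ _)%N; apply/eqP; rewrite eqn_leq lei ltnNge.
  by apply: contra nx => leim; rewrite -order_dvdn oi dvdn_exp2l.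
have ordp x : x \in K -> x ^+ (2 ^ m) != 1 -> #[x ^+ (2 ^ m)] = 2%N.
  by move=> Kx nx; apply: nt_prime_order; rewrite // -expgM -expnSr expK.
have same x : x \in K -> x ^+ (2 ^ m) != 1 -> x ^+ (2 ^ m) = x0 ^+ (2 ^ m).
  move=> Kx nx; apply/eqP; apply: contraLR ltnm => neq.
  have TI : <[x]> :&: <[x0]> = 1.
    apply/eqP; rewrite trivg_card1; apply: contraR neq => ntI.
    have pI : 2.-group (<[x]> :&: <[x0]>).
      by apply: pgroupS pK; rewrite subIset // cycle_subG Kx.
    have [|_ dvI _] := pgroup_pdiv pI; first by rewrite trivg_card1.
    have [y /setIP[xy x0y] oy] := Cauchy (isT : prime 2) dvI.
    have -> : x ^+ (2 ^ m) = y by apply: (@cycle_involution_uniq x); rewrite ?mem_cycle ?ordp.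
    by apply/eqP/(@cycle_involution_uniq x0); rewrite ?mem_cycle ?ordp.
  have := TI_cardMg TI; rewrite -!orderE !ord // -expnD => cM.
  rewrite -leqNgt -(@leq_exp2l 2) // -cardK mul2n -addnn -cM subset_leq_card //.
  by rewrite mul_subG ?cycle_subG.
exists T; split=> //.
- by apply/subsetP=> x Ax; rewrite TP (subsetP sAK) ?expA ?eqxx.
- have nTx0 : x0 \notin T by rewrite TP Kx0.
  have leK : (#|K| <= #|T| + #|x0 *: T|)%N.
    apply: leq_trans (leq_card_setU _ _); apply/subset_leq_card/subsetP => x Kx.
    rewrite inE TP Kx /=; have [//|nx] := eqVneq (x ^+ (2 ^ m)) 1.
    rewrite mem_lcoset TP groupM ?groupV //= expgMn; last first.
      by apply: (centsP abK); rewrite ?groupV.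
    by rewrite expgVn (same x Kx nx) mulVg eqxx.
  apply/eqP; rewrite eqn_leq -(@leq_pmul2l #|T|) ?cardG_gt0 // Lagrange //.
  rewrite card_lcoset addnn -muln2 in leK; rewrite leK /=.
  by rewrite (indexg_gt1 K T); apply: contra nTx0 => /subsetP->.
by move=> x; rewrite TP => /andP[_ /eqP].
Qed.

End AbelianTwoGroups.

(** * Perfect functions relative to an involution *)

Notation Z33 := ('Z_3 * 'Z_3)%type.

(** An explicit list, so that sums over [Z33] become a [foldr] that evaluates by computation. *)
Definition enum_Z3 : seq 'Z_3 := [:: inZp 0; inZp 1; inZp 2].

Definition enum_Z33 : seq Z33 := [seq (i, j) | i <- enum_Z3, j <- enum_Z3].

Lemma mem_enum_Z33 (z : Z33) : z \in enum_Z33.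
Proof.
have memZ3 (i : 'Z_3) : i \in enum_Z3 by case: i => [[|[|[|]]]].
by case: z => i j; apply: allpairs_f; apply: memZ3.
Qed.

Lemma sum_Z33 (V : nmodType) (F : Z33 -> V) :
  \sum_z F z = \sum_(z <- enum_Z33) F z.
Proof.
apply: perm_big; apply: uniq_perm => [||z]; rewrite ?index_enum_uniq //.
by rewrite mem_index_enum mem_enum_Z33.
Qed.

Lemma sum_Z33_foldr (F : Z33 -> int) :
  \sum_z F z = foldr (fun z s => F z + s) 0 enum_Z33.
Proof. by rewrite sum_Z33 unlock. Qed.

Lemma cardZ33 : #|{: Z33}| = 9%N.
Proof. by rewrite card_prod !card_ord. Qed.

(* The four lines through 0 of the plane Z_3^2. *)
Definition line_sign (k : nat) (z : Z33) : int :=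
  if nth z.1 [:: z.1; z.2; z.1 + z.2; z.1 - z.2] k == 0 then -1 else 1.

Definition plane_corr (p q : Z33 -> int) (a : Z33) : int :=
  \sum_z p z * q (z * a)%g.

Lemma line_sign_sq k z : line_sign k z ^+ 2 = 1.
Proof. by rewrite /line_sign; case: ifP. Qed.

(** Translates of two distinct lines meet in exactly one point, so the sum is 9 - 6 - 6 + 4. *)
Lemma line_sign_cross i j a : (i < 4)%N -> (j < 4)%N -> i != j ->
  plane_corr (line_sign i) (line_sign j) a = 1.
Proof.
have /allP check : all (fun a => all (fun i => all (fun j => (i == j) ||
   (foldr (fun z s => line_sign i z * line_sign j (z * a)%g + s) 0 enum_Z33 == 1))
   (iota 0 4)) (iota 0 4)) enum_Z33 by vm_compute.
move=> lti ltj neij; rewrite /plane_corr sum_Z33_foldr.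
have := check a (mem_enum_Z33 a).
move/allP/(_ i); rewrite mem_iota lti => /(_ isT)/allP/(_ j).
by rewrite mem_iota ltj (negPf neij) => /(_ isT)/eqP.
Qed.

(** For [a] nonzero, the line through [a] contributes 9 and each of the other three, disjoint from
    its translate, contributes 9 - 12 = -3. *)
Lemma line_sign_auto a :
  plane_corr (line_sign 0) (line_sign 0) a + plane_corr (line_sign 1) (line_sign 1) a
  + (plane_corr (line_sign 2) (line_sign 2) a + plane_corr (line_sign 3) (line_sign 3) a)
  = 36 * (a == 1%g)%:R.
Proof.
pose c k a := foldr (fun z s => line_sign k z * line_sign k (z * a)%g + s) 0 enum_Z33.
have /allP check : all (fun a => c 0%N a + c 1%N a + (c 2 a + c 3 a) ==
    36 * (a == 1%g)%:R) enum_Z33 by vm_compute.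
by rewrite /plane_corr !sum_Z33_foldr; apply/eqP/check/mem_enum_Z33.
Qed.

(** * Antisymmetric functions on a Klein four-group *)

Section KleinFour.

Variables (gT : finGroupType) (K : {group gT}) (u w : gT).
Hypotheses (abK : abelian K) (Ku : u \in K) (Kw : w \in K).
Hypotheses (ou : #[u]%g = 2%N) (ow : #[w]%g = 2%N) (nuw : u != w).

Let B : {group gT} := (<[u]> <*> <[w]>)%G.
Let v : gT := (u * w)%g.

Let uu : (u * u = 1)%g. Proof. by rewrite -expg2 -ou expg_order. Qed.
Let ww : (w * w = 1)%g. Proof. by rewrite -expg2 -ow expg_order. Qed.
Let wu : (w * u = v)%g. Proof. exact: (centsP abK). Qed.
Let uv : (u * v = w)%g. Proof. by rewrite mulgA uu mul1g. Qed.
Let vu : (v * u = w)%g. Proof. by rewrite -mulgA wu uv. Qed.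
Let vw : (v * w = u)%g. Proof. by rewrite -mulgA ww mulg1. Qed.
Let wv : (w * v = u)%g. Proof. by rewrite -wu mulgA ww mul1g. Qed.
Let vv : (v * v = 1)%g. Proof. by rewrite -{1}wu -mulgA uv ww. Qed.
Let u1 : u != 1%g. Proof. by rewrite -order_eq1 ou. Qed.
Let w1 : w != 1%g. Proof. by rewrite -order_eq1 ow. Qed.
Let vnu : v != u. Proof. by rewrite -[X in _ != X]mulg1 (inj_eq (mulgI u)). Qed.
Let vnw : v != w. Proof. by rewrite -[X in _ != X]mul1g (inj_eq (mulIg w)). Qed.
Let v1 : v != 1%g.
Proof. by apply: contra nuw => /eqP v1; rewrite -vu v1 mul1g. Qed.
Let wnu : w != u. Proof. by rewrite eq_sym. Qed.

Let mulE := (@mul1g gT, @mulg1 gT, uu, ww, wu, uv, vu, vw, wv, vv).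
Let neqE := (negPf u1, negPf w1, negPf vnu, negPf vnw, negPf v1, negPf wnu).

Let eqE' : (((1%g == u) = false) * ((1%g == w) = false) * ((1%g == v) = false)
  * ((u == w) = false) * ((u == v) = false) * ((w == v) = false))%type.
Proof. by do !split; apply/negbTE; rewrite // eq_sym. Qed.

Lemma klein_set : B = [set 1; u; w; v]%g :> {set gT}.
Proof.
have cuw : (<[w]> \subset 'C(<[u]>))%g.
  by apply: (sub_abelian_cent2 abK); rewrite cycle_subG.
rewrite /B /= (cent_joinEr cuw); apply/setP=> x; rewrite !inE -!orbA.
apply/imset2P/or4P=> [[y z]|].
  rewrite !mem_cycle2 // => /orP[]/eqP-> /orP[]/eqP-> ->; rewrite ?mulE.
  - by constructor 1.
  - by constructor 3.
  - by constructor 2.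
  - by constructor 4.
by case=> /eqP->; [exists 1%g 1%g | exists u 1%g | exists 1%g w | exists u w];
  rewrite ?group1 ?cycle_id ?mulE.
Qed.

Lemma klein_sum (V : nmodType) (F : gT -> V) :
  \sum_(x in B) F x = F 1%g + F u + F w + F v.
Proof.
rewrite klein_set (setUC _ [set v]) big_setU1 ?inE ?neqE //.
rewrite (setUC _ [set w]) big_setU1 ?inE ?neqE //.
rewrite big_setU1 ?inE ?(eq_sym 1%g) ?neqE // big_set1 /=.
by rewrite addrC (addrC (F w)).
Qed.

Lemma klein_card : #|B| = 4%N.
Proof. by rewrite -sum1_card klein_sum. Qed.

(** The function antisymmetric under [u] with [p] at 1 and [q] at [w]; the last branch is meant for
    [u * w]. *)
Definition klein (p q : Z33 -> int) : Z33 -> gT -> int := fun z x =>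
  if x == 1%g then p z else if x == u then - p z else if x == w then q z else - q z.

Let klein1 p q z : klein p q z 1%g = p z. Proof. by rewrite /klein eqxx. Qed.
Let kleinu p q z : klein p q z u = - p z. Proof. by rewrite /klein !neqE eqxx. Qed.
Let kleinw p q z : klein p q z w = q z. Proof. by rewrite /klein !neqE eqxx. Qed.
Let kleinv p q z : klein p q z v = - q z. Proof. by rewrite /klein !neqE. Qed.

Let kleinE := (klein1, kleinu, kleinw, kleinv).

Lemma klein_corr p q p' q' a t : t \in B ->
  corr B (klein p q) (klein p' q') a t =
  2%:R * ((plane_corr p p' a + plane_corr q q' a) * ((t == 1%g)%:R - (t == u)%:R) +
          (plane_corr p q' a + plane_corr q p' a) * ((t == w)%:R - (t == v)%:R)).
Proof.
move=> Bt; have {Bt} : t \in [set 1; u; w; v]%g by rewrite -klein_set.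
rewrite !inE -!orbA /corr /plane_corr.
under eq_bigr => z _ do rewrite klein_sum !kleinE !mul1g.
rewrite -!big_split /= !mulr_suml -big_split mulr_sumr /= => Bt.
apply: eq_bigr => z _; case/or4P: Bt => /eqP->;
  by rewrite ?mulE ?kleinE ?eqxx ?neqE ?eqE' /=; ring.
Qed.

Lemma klein_anti p q z x : x \in B ->
  klein p q z (x * u)%g = - klein p q z x.
Proof.
move=> Bx; have {Bx} : x \in [set 1; u; w; v]%g by rewrite -klein_set.
rewrite !inE -!orbA => /or4P[]/eqP->; rewrite ?mulE ?kleinE ?opprK //.
Qed.

End KleinFour.

Lemma rel_perfect_base (gT : finGroupType) (K : {group gT}) (u : gT) :
  abelian K -> #|K| = 8%N -> {in K, forall x, x ^+ 4 = 1}%g -> u \in K ->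
  #[u]%g = 2%N -> exists f : Z33 -> gT -> int, rel_perfect K u f.
Proof.
move=> abK cardK expK Ku ou.
have [w [Kw ow nuw']] :
    exists w, [/\ w \in K, #[w]%g = 2%N & w \notin <[u]>%g].
  exact: (@involution_outside_cycle _ K u 2 3).
have nuw : u != w by apply: contraNneq nuw' => <-; apply: cycle_id.
pose B := (<[u]> <*> <[w]>)%G.
have cardB : #|B| = 4%N by apply: (klein_card abK).
have sBK : B \subset K by rewrite join_subG !cycle_subG Ku.
have iBK : #|K : B|%g = 2%N.
  by apply/eqP; rewrite -(eqn_pmul2l (cardG_gt0 B)) Lagrange // cardK cardB.
have [g Kg nBg] : exists2 g, g \in K & g \notin B.
  by apply/subsetPn; rewrite -indexg_gt1 iBK.
have Bu : u \in B by rewrite mem_gen // inE cycle_id.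
have Bw : w \in B by rewrite mem_gen // inE cycle_id orbT.
pose f1 : Z33 -> gT -> int := klein u w (line_sign 0) (line_sign 1).
pose f2 : Z33 -> gT -> int := klein u w (line_sign 2) (fun z => - line_sign 3 z).
have corrE := klein_corr abK Ku Kw ou ow nuw.
have corrNr p q a : plane_corr p (fun z => - q z) a = - plane_corr p q a.
  by rewrite /plane_corr -sumrN; apply: eq_bigr => z _; rewrite mulrN.
have corrNl p q a : plane_corr (fun z => - p z) q a = - plane_corr p q a.
  by rewrite /plane_corr -sumrN; apply: eq_bigr => z _; rewrite mulNr.
have sq p q : (forall z, p z ^+ 2 = 1) -> (forall z, q z ^+ 2 = 1) ->
    forall z x, klein u w p q z x ^+ 2 = 1.
  by move=> sqp sqq z x; rewrite /klein; repeat case: ifP => _; rewrite ?sqrrN.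
have anti p q z x : x \in B -> klein u w p q z (x * u)%g = - klein u w p q z x.
  by move=> Bx; apply: (klein_anti abK).
exists (glue B g f1 f2); split.
- apply: (glue_sq abK sBK iBK Kg nBg) => z x _; apply: sq => {}z; rewrite ?sqrrN line_sign_sq //.
- move=> z x Kx; rewrite /glue groupMr //; case: ifPn => Bx; first exact: anti.
  by rewrite mulgA; apply/anti/(index2_quo abK sBK iBK Kg nBg).
move=> a t Kt; rewrite (corr_glue abK sBK iBK Kg nBg) //; first last.
- by move=> b s Bs; rewrite corrE // !corrNl !line_sign_cross //; ring.
- by move=> b s Bs; rewrite corrE // !corrNr !line_sign_cross //; ring.
case: ifPn => Bt; last first.
  have -> : t == 1%g = false by apply: contraNF Bt => /eqP->.
  have -> : t == u = false by apply: contraNF Bt => /eqP->.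
  by rewrite subrr !mulr0.
rewrite !corrE // !corrNl !corrNr !opprK cardK cardZ33.
rewrite (@line_sign_cross 0 1) // (@line_sign_cross 1 0) //.
rewrite (@line_sign_cross 2 3) // (@line_sign_cross 3 2) //.
have := line_sign_auto a.
set c0 := plane_corr (line_sign 0) _ a; set c1 := plane_corr (line_sign 1) _ a.
set c2 := plane_corr (line_sign 2) _ a; set c3 := plane_corr (line_sign 3) _ a.
set d := (a == _)%:R => E; have -> : c0 = 36 * d - c1 - c2 - c3 by rewrite -E; ring.
ring.
Qed.

(** Induction by [rel_perfect_step]: [index2_low_exponent] gives [B] containing [u] with exponent
    dividing 2^(e+2), and an involution [w] of [B] outside [<[u]>] gives the quotients by [w] and
    [u * w], both of order 2^(2e+3), in which [u] remains an involution. *)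
Lemma rel_perfect_exists (e : nat) (gT : finGroupType) (K : {group gT}) (u : gT) :
  abelian K -> #|K| = (2 ^ (2 * e + 3))%N ->
  {in K, forall x, x ^+ (2 ^ e.+2) = 1}%g -> u \in K -> #[u]%g = 2%N ->
  exists f : Z33 -> gT -> int, rel_perfect K u f.
Proof.
elim: e => [|e IHe] in gT K u *; first exact: rel_perfect_base.
move=> abK cardK expK Ku ou.
have u2 x : x \in <[u]>%g -> (x ^+ (2 ^ e.+2) = 1)%g.
  move=> ux; apply/eqP; rewrite -order_dvdn.
  apply: dvdn_trans (_ : 2 %| _)%N; last by rewrite expnS dvdn_mulr.
  by rewrite -ou orderE order_dvdG.
have [|||B [suB sBK iBK expB]] :=
  index2_low_exponent (A := <[u]>%G) abK cardK (_ : _ < 2 * e.+3)%N expK _ _ u2.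
- lia.
- by rewrite cycle_subG.
- by apply/eqP=> uK; have := cardK; rewrite -uK -orderE ou mulnS !expnS; lia.
have Bu : u \in B by rewrite -cycle_subG.
have abB := abelianS sBK abK.
have cardB : #|B| = (2 ^ (2 * e + 4))%N.
  have := Lagrange sBK; rewrite iBK cardK (_ : 2 * e.+1 + 3 = (2 * e + 4).+1)%N; last lia.
  by rewrite expnS mulnC => /eqP; rewrite eqn_pmul2l // => /eqP.
have [|w [Bw ow nuw]] := @involution_outside_cycle _ B u e.+2 _ abB cardB _ expB.
  lia.
have neuw : u != w by apply: contraNneq nuw => <-; apply: cycle_id.
have [g Kg nBg] : exists2 g, g \in K & g \notin B.
  by apply/subsetPn; rewrite -indexg_gt1 iBK.
have quo v : v \in B -> #[v]%g = 2%N -> u \notin <[v]>%g ->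
    exists f : Z33 -> _ -> int, rel_perfect (B / <[v]>)%g (coset <[v]> u) f.
  move=> Bv ov nvu; have svB : <[v]>%g \subset B by rewrite cycle_subG.
  have nvB : B \subset 'N(<[v]>)%g.
    exact: subset_trans (sub_abelian_cent abB svB) (cent_sub _).
  apply: IHe.
  - exact: quotient_abelian.
  - rewrite card_quotient //; have := Lagrange svB; rewrite -orderE ov cardB addnS expnS.
    by move/eqP; rewrite eqn_pmul2l // => /eqP.
  - move=> _ /morphimP[x Nx Bx ->].
    by rewrite -morphX //= expB // morph1.
  - exact: mem_quotient.
  apply: nt_prime_order => //.
    by rewrite -morphX ?(subsetP nvB) //= -[2%N]ou expg_order morph1.
  by rewrite (coset_eq1E abB svB).
have uv : u != 1%g by rewrite -order_eq1 ou.
have wv : w != 1%g by rewrite -order_eq1 ow.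
have uu : (u * u = 1)%g by rewrite -expg2 -ou expg_order.
have ww : (w * w = 1)%g by rewrite -expg2 -ow expg_order.
have ouw : #[(u * w)%g]%g = 2%N.
  apply: nt_prime_order => //.
    by rewrite expgMn ?expg2 ?uu ?ww ?mulg1 //; apply: (centsP abB).
  apply: contra neuw => /eqP uw1; apply/eqP.
  by rewrite -[u]mulg1 -ww mulgA uw1 mul1g.
have [|f1 rel1] := quo w Bw ow.
  by rewrite mem_cycle2 // negb_or uv.
have [|f2 rel2] := quo _ (groupM Bu Bw) ouw.
  by rewrite mem_cycle2 // negb_or uv -{1}[u]mulg1 (inj_eq (mulgI u)) eq_sym.
exact: (rel_perfect_step abK sBK iBK Kg nBg Bu Bw ou ow neuw rel1 rel2).
Qed.

(** * A non-naive perfect function on Z_3^2 x Z_8 x Z_2 *)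

Section NonNaiveBase.

(* Found by computer.  The supports of A, B, C, D partition Z_3^2 x {0..3}; A and
   B have all character values of modulus 3 when extended to Z_3^2 x Z_8 by
   A(z, j + 4) = - A(z, j), and so have C and D on Z_3^2 x Z_4.  Rows are indexed
   by j, and the column of z is 3 * z.1 + z.2. *)

Definition coefA : seq (seq int) :=
  [:: [:: 1;  0;  0;  0;  1;  0;  0;  0;  1];
      [:: -1; 0;  0;  0;  0;  0;  0;  0;  1];
      [:: -1; 0;  0;  0;  0;  0;  0;  0;  1];
      [:: 1;  0;  0;  0;  0;  0;  0;  0; -1]].

Definition coefB : seq (seq int) :=
  [:: [:: 0;  0; -1;  0;  0;  0;  1;  0;  0];
      [:: 0;  0;  1;  0;  1;  0;  1;  0;  0];
      [:: 0;  0; -1;  0;  0;  0;  1;  0;  0];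
      [:: 0;  0; -1;  0;  0;  0;  1;  0;  0]].

Definition coefC : seq (seq int) :=
  [:: [:: 0;  0;  0;  0;  0;  0;  0;  0;  0];
      [:: 0;  1;  0; -1;  0; -1;  0;  1;  0];
      [:: 0;  1;  0;  1; -1;  1;  0;  1;  0];
      [:: 0;  0;  0;  0;  0;  0;  0;  0;  0]].

Definition coefD : seq (seq int) :=
  [:: [:: 0;  1;  0; -1;  0; -1;  0;  1;  0];
      [:: 0;  0;  0;  0;  0;  0;  0;  0;  0];
      [:: 0;  0;  0;  0;  0;  0;  0;  0;  0];
      [:: 0;  1;  0;  1; -1;  1;  0;  1;  0]].

(** Each character sees one coefficient table: its value at the involution of Z_8 separates A, B
    from C, D, and its value on Z_2 separates A, C from B, D. The character value is 4 times the sum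
    over Z_3^2 x {0..3} of that table, and 144 = (4 * 3)^2. *)
Definition table (z : Z33) (j b : nat) : int :=
  let entry t := nth 0 (nth [::] t (j %% 4)) (3 * z.1 + z.2) in
  entry coefC + (-1) ^+ b * entry coefD +
  (if (j < 4)%N then 1 else -1) * (entry coefA + (-1) ^+ b * entry coefB).

Definition table_corr (a : Z33) (j b : nat) : int :=
  foldr (fun z s => foldr (fun i s => foldr (fun c s =>
    table z i c * table (z * a)%g ((i + j) %% 8) ((c + b) %% 2) + s)
    0 (iota 0 2) + s) 0 (iota 0 8) + s) 0 enum_Z33.

Lemma table_corr_sum a j b : table_corr a j b =
  \sum_z \sum_(0 <= i < 8) \sum_(0 <= c < 2)
    table z i c * table (z * a)%g ((i + j) %% 8) ((c + b) %% 2).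
Proof. by rewrite sum_Z33 unlock. Qed.

Lemma table_sq z j b : (j < 8)%N -> (b < 2)%N -> table z j b ^+ 2 = 1.
Proof.
have /allP check : all (fun z => all (fun j => all (fun b =>
    table z j b ^+ 2 == 1) (iota 0 2)) (iota 0 8)) enum_Z33 by vm_compute.
move=> ltj ltb; have /allP/(_ j) := check z (mem_enum_Z33 z).
by rewrite mem_iota ltj => /(_ isT)/allP/(_ b); rewrite mem_iota ltb => /(_ isT)/eqP.
Qed.

Lemma table_corrE a j b : (j < 8)%N -> (b < 2)%N ->
  table_corr a j b = 144 * ((a == 1%g) && ((j == 0%N) && (b == 0%N)))%:R.
Proof.
have /allP check : all (fun a => all (fun j => all (fun b =>
    table_corr a j b == 144 * ((a == 1%g) && ((j == 0%N) && (b == 0%N)))%:R)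
    (iota 0 2)) (iota 0 8)) enum_Z33 by vm_compute.
move=> ltj ltb; have /allP/(_ j) := check a (mem_enum_Z33 a).
by rewrite mem_iota ltj => /(_ isT)/allP/(_ b); rewrite mem_iota ltb => /(_ isT)/eqP.
Qed.

End NonNaiveBase.

Lemma cube_root_one (omega : algC) : 1 + omega + omega ^+ 2 = 0 -> omega ^+ 3 = 1.
Proof.
move=> omega_eq; apply/eqP; rewrite -subr_eq0; apply/eqP.
have -> : omega ^+ 3 - 1 = (omega - 1) * (1 + omega + omega ^+ 2) by ring.
by rewrite omega_eq mulr0.
Qed.

Lemma cube_root_exists :
  exists2 omega : algC, 1 + omega + omega ^+ 2 = 0 & omega^* = omega ^+ 2.
Proof.
have [omega omega_prim] := C_prim_root_exists (isT : (0 < 3)%N).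
have omega3 := prim_expr_order omega_prim.
exists omega.
  have : (omega - 1) * (1 + omega + omega ^+ 2) = 0.
    have -> : (omega - 1) * (1 + omega + omega ^+ 2) = omega ^+ 3 - 1 by ring.
    by rewrite omega3 subrr.
  move/eqP; rewrite mulf_eq0 subr_eq0 => /orP[/eqP omega1|/eqP //].
  by have := eq_prim_root_expr omega_prim 1 0; rewrite expr1 expr0 omega1 eqxx.
have norm1 : `|omega| = 1.
  by apply/eqP; rewrite -(@pexpr_eq1 _ _ 3) // -normrX omega3 normr1.
have omega_unit : omega * omega^* = 1 by rewrite -normCK norm1 expr1n.
by rewrite -[LHS]mul1r -omega3 exprSr -mulrA omega_unit mulr1.
Qed.

Section NonNaivePerfect.

Variables omega zeta : algC.
Hypotheses (omega_eq : 1 + omega + omega ^+ 2 = 0) (zeta_eq : zeta ^+ 4 = -1).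

Definition psi (z : Z33) : algC := omega ^+ (z.1 : nat).

(** The value of [table] at the character given by [psi], [zeta] on Z_8 and 1 on Z_2, divided by 12.
    For [zeta] a primitive 8th root of unity its modulus is 1, yet it is no root of unity. *)
Definition beta : algC := (1 - omega ^+ 2) * zeta * (zeta ^+ 2 - zeta - 1) / 3%:R.

Let zeta8 : zeta ^+ 8 = 1.
Proof. by rewrite (exprM zeta 4 2) zeta_eq sqrrN expr1n. Qed.

Lemma table_fourier :
  \sum_z \sum_(0 <= i < 8) \sum_(0 <= b < 2)
    psi z * zeta ^+ i * (table z i b)%:~R = 12%:R * beta.
Proof.
(* The character depends neither on [z.2] nor on [b]; summing these out leaves a 3 by 8 table of
   integers, found by computation. *)
pose c a i : int := \sum_(z2 <- enum_Z3) \sum_(0 <= b < 2) table (inZp a, z2) i b.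
have -> : \sum_z \sum_(0 <= i < 8) \sum_(0 <= b < 2)
    psi z * zeta ^+ i * (table z i b)%:~R =
  \sum_(0 <= a < 3) \sum_(0 <= i < 8) omega ^+ a * zeta ^+ i * (c a i)%:~R.
  rewrite sum_Z33 big_allpairs_dep big_mkord.
  have sum_Z3 (F : 'Z_3 -> algC) :
      \sum_(z1 <- enum_Z3) F z1 = \sum_(a < 3) F (inZp a).
    by rewrite !big_cons big_nil !big_ord_recl big_ord0.
  rewrite sum_Z3; apply: eq_bigr => a _.
  rewrite exchange_big /=; apply: eq_bigr => i _.
  rewrite rmorph_sum mulr_sumr /=.
  apply: eq_bigr => z2 _; rewrite rmorph_sum mulr_sumr; apply: eq_bigr => b _.
  by rewrite /psi /= modn_small.
have cE : [seq [seq c a i | i <- iota 0 8] | a <- iota 0 3] =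
    [:: [:: 2; 0; 0; 2; -2; 4; 4; -2];
        [:: 2; -4; 2; 0; -2; -4; 2; 0];
        [:: 2; 4; 4; -2; -2; 0; 0; 2]].
  by rewrite /c unlock; vm_compute.
clearbody c; move: cE => /= [e00 e01 e02 e03 e04 e05 e06 e07].
move=> e10 e11 e12 e13 e14 e15 e16 e17 e20 e21 e22 e23 e24 e25 e26 e27.
rewrite unlock /= e00 e01 e02 e03 e04 e05 e06 e07 e10 e11 e12 e13 e14 e15 e16 e17.
rewrite e20 e21 e22 e23 e24 e25 e26 e27 /beta.
have z5 : zeta ^+ 5 = - zeta by rewrite (exprD _ 4 1) zeta_eq; ring.
have z6 : zeta ^+ 6 = - zeta ^+ 2 by rewrite (exprD _ 4 2) zeta_eq; ring.
have z7 : zeta ^+ 7 = - zeta ^+ 3 by rewrite (exprD _ 4 3) zeta_eq; ring.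
rewrite zeta_eq z5 z6 z7.
have -> : omega ^+ 2 = - 1 - omega by apply/eqP; rewrite -subr_eq0 -omega_eq; apply/eqP; ring.
by field.
Qed.

Section SmallGroup.

Variables (gT : finGroupType) (K : {group gT}) (x y : gT).
Hypotheses (abK : abelian K) (cardK : #|K| = 16%N) (Kx : x \in K) (Ky : y \in K).
Hypotheses (ox : #[x]%g = 8%N) (oy : #[y]%g = 2%N) (nxy : y \notin <[x]>%g).

Let elt (p : 'I_8 * 'I_2) : gT := (x ^+ p.1 * y ^+ p.2)%g.

Let elt_inj : injective elt.
Proof.
have ycase (b c : 'I_2) (i j : nat) : (x ^+ i * y ^+ b = x ^+ j * y ^+ c)%g -> b = c.
  move=> E; have : (y ^+ b * y ^- c \in <[x]>)%g.
    have -> : (y ^+ b * y ^- c = x ^- i * x ^+ j)%g.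
      by rewrite -(mulKg (x ^+ i) (y ^+ b))%g E -!mulgA mulgV mulg1.
    by rewrite groupM ?groupV ?mem_cycle.
  case: b c {E} => [[|[|]]] //= ? [[|[|]]] //= ?; rewrite ?expg0 ?expg1 ?invg1 ?mul1g ?mulg1 ?groupV ?(negPf nxy) // => _; exact: val_inj.
case=> i b [j c]; rewrite /elt /= => E; have bc := ycase _ _ _ _ E; subst c.
move/mulIg/eqP: E; rewrite eq_expg_mod_order ox !modn_small // => /eqP E.
by congr (_, _); apply: val_inj.
Qed.

Let eltP g : g \in K -> exists p, g = elt p.
Proof.
move=> Kg; have : g \in [set elt p | p in predT].
  suff -> : [set elt p | p in predT] = K by [].
  apply/eqP; rewrite eqEcard card_imset // cardK card_prod !card_ord andbT.
  by apply/subsetP=> _ /imsetP[p _ ->]; rewrite groupM ?groupX.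
by case/imsetP=> p _ ->; exists p.
Qed.

Let sum_elt (V : nmodType) (F : gT -> V) :
  \sum_(g in K) F g = \sum_(0 <= i < 8) \sum_(0 <= b < 2) F (x ^+ i * y ^+ b)%g.
Proof.
have -> : \sum_(g in K) F g = \sum_(g in [set elt p | p in predT]) F g.
  apply: eq_bigl => g; apply/idP/imsetP => [/eltP[p ->]|[p _ ->]]; first by exists p.
  by rewrite groupM ?groupX.
rewrite big_imset /=; last by move=> p q _ _; apply: elt_inj.
rewrite -(pair_bigA _ (fun (i : 'I_8) (b : 'I_2) => F (x ^+ i * y ^+ b)%g)) /=.
by rewrite big_mkord; apply: eq_bigr => i _; rewrite big_mkord.
Qed.

(** The inverse of [elt]; the default is reached only outside [K]. *)
Let coord (g : gT) : 'I_8 * 'I_2 := odflt (ord0, ord0) [pick p | elt p == g].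

Let coordK p : coord (elt p) = p.
Proof.
rewrite /coord; case: pickP => [q /eqP/elt_inj //|/(_ p)].
by rewrite eqxx.
Qed.

Let coordE i b : coord (x ^+ i * y ^+ b)%g = (inord (i %% 8), inord (b %% 2)).
Proof.
rewrite -[RHS]coordK /elt /= !inordK ?ltn_pmod //.
by have := expg_mod_order x i; have := expg_mod_order y b; rewrite ox oy => -> ->.
Qed.

Lemma non_naive_base : exists (f : Z33 -> gT -> int) (phi : gT -> algC),
  [/\ perfect K f, char_on K phi & fourier K psi phi f = 12%:R * beta].
Proof.
pose f (z : Z33) (g : gT) := table z (coord g).1 (coord g).2.
have fE z i b : f z (x ^+ i * y ^+ b)%g = table z (i %% 8) (b %% 2).
  by rewrite /f coordE /= !inordK ?ltn_pmod.
pose phi (g : gT) : algC := zeta ^+ (coord g).1.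
have phiE i b : phi (x ^+ i * y ^+ b)%g = zeta ^+ i.
  by rewrite /phi coordE /= inordK ?ltn_pmod // expr_mod.
have mulE i b j c : (x ^+ i * y ^+ b * (x ^+ j * y ^+ c) = x ^+ (i + j) * y ^+ (b + c))%g.
  rewrite !expgD -!mulgA; congr (_ * _)%g; rewrite !mulgA; congr (_ * _)%g.
  by apply: (centsP abK); rewrite groupX.
exists f, phi; split.
- split=> [z g /eltP[p ->]|a t /eltP[[j b] ->]].
    by rewrite /elt fE table_sq ?ltn_pmod.
  rewrite /corr; under eq_bigr => z _ do rewrite sum_elt.
  under eq_bigr => z _ do under eq_bigr => i _ do under eq_bigr => c _ do
    rewrite /elt /= mulE !fE.
  have := table_corr_sum a j b; rewrite table_corrE // => E.
  transitivity (144 * ((a == 1%g) && ((j == 0%N :> nat) && (b == 0%N :> nat)))%:R : int).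
    rewrite E; apply: eq_bigr => z _.
    rewrite big_nat [RHS]big_nat; apply: eq_bigr => i /andP[_ lti].
    rewrite big_nat [RHS]big_nat; apply: eq_bigr => c /andP[_ ltc].
    by rewrite (modn_small lti) (modn_small ltc).
  rewrite cardZ33 cardK; congr (_ * (_ && _)%:R).
  have e0 : elt (ord0, ord0) = 1%g by rewrite /elt /= !expg0 mulg1.
  by rewrite -[1%g in RHS]e0 (inj_eq elt_inj).
- split=> [|g h /eltP[p ->] /eltP[q ->]]; first by have := phiE 0%N 0%N; rewrite !expg0 mulg1 expr0.
  by rewrite /elt mulE !phiE exprD.
rewrite -table_fourier /fourier; apply: eq_bigr => z _; rewrite sum_elt.
rewrite big_nat [RHS]big_nat; apply: eq_bigr => i /andP[_ lti].
rewrite big_nat [RHS]big_nat; apply: eq_bigr => c /andP[_ ltc].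
by rewrite phiE fE !modn_small.
Qed.

End SmallGroup.

End NonNaivePerfect.

(** * Non-naive perfect functions on Z_3^2 x K by induction *)

Section NonNaiveExists.

Variables omega zeta : algC.
Hypotheses (omega_eq : 1 + omega + omega ^+ 2 = 0) (zeta_eq : zeta ^+ 4 = -1).

(** Induction by [perfect_step]. The index 2 subgroup [B] contains [x], [rel_perfect_exists]
    supplies the relative function on it, and [w] is chosen outside [<[x]>] so that [x] keeps order
    8 in the quotient. *)
Lemma non_naive_perfect_exists (e : nat) (gT : finGroupType) (K : {group gT}) (x : gT) :
  abelian K -> #|K| = (2 ^ (2 * e + 4))%N ->
  {in K, forall y, y ^+ (2 ^ e.+3) = 1}%g -> x \in K -> #[x]%g = 8%N ->
  exists (f : Z33 -> gT -> int) (phi : gT -> algC),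
    [/\ perfect K f, char_on K phi
      & fourier K (psi omega) phi f = (12 * 2 ^ e)%:R * beta omega zeta].
Proof.
elim: e => [|e IHe] in gT K x *.
  move=> abK cardK expK Kx ox; rewrite muln1.
  have [|y [Ky oy nxy]] := @involution_outside_cycle _ K x 3 4 abK cardK _ expK.
    by [].
  exact: (non_naive_base omega_eq zeta_eq abK cardK Kx Ky ox oy nxy).
have e3 : (2 * e.+1 + 3 = (2 * e + 4).+1)%N by lia.
have e4 : (2 * e.+1 + 4 = (2 * e.+1 + 3).+1)%N by lia.
move=> abK cardK expK Kx ox.
have x8 y : y \in <[x]>%g -> (y ^+ (2 ^ e.+3) = 1)%g.
  move=> xy; apply/eqP; rewrite -order_dvdn.
  apply: dvdn_trans (_ : 8 %| _)%N; last by rewrite !expnS !mulnA dvdn_mulr.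
  by rewrite -ox orderE order_dvdG.
have [|||B [sxB sBK iBK expB]] :=
  index2_low_exponent (A := <[x]>%G) abK cardK (_ : _ < 2 * e.+4)%N expK _ _ x8.
- lia.
- by rewrite cycle_subG.
- by apply/eqP=> xK; have := cardK; rewrite -xK -orderE ox => /eqP; rewrite -[8%N]/(2 ^ 3)%N eqn_exp2l //; lia.
have Bx : x \in B by rewrite -cycle_subG.
have abB := abelianS sBK abK.
have cardB : #|B| = (2 ^ (2 * e.+1 + 3))%N.
  have := Lagrange sBK; rewrite iBK cardK e4.
  by rewrite expnS mulnC => /eqP; rewrite eqn_pmul2l // => /eqP.
have [|w [Bw ow nxw]] := @involution_outside_cycle _ B x e.+3 _ abB cardB _ expB.
  lia.
have [g Kg nBg] : exists2 g, g \in K & g \notin B.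
  by apply/subsetPn; rewrite -indexg_gt1 iBK.
have swB : <[w]>%g \subset B by rewrite cycle_subG.
have nwB : B \subset 'N(<[w]>)%g.
  exact: subset_trans (sub_abelian_cent abB swB) (cent_sub _).
have [f2 rel2] := rel_perfect_exists abB cardB expB Bw ow.
have [||||| f1 [phi [perf1 phiB fou]]] := IHe _ (B / <[w]>)%G (coset <[w]> x).
- exact: quotient_abelian.
- rewrite card_quotient //; have := Lagrange swB; rewrite -orderE ow cardB.
  rewrite e3.
  by rewrite expnS => /eqP; rewrite eqn_pmul2l // => /eqP.
- move=> _ /morphimP[y Ny By ->].
  by rewrite -morphX //= expB // morph1.
- exact: mem_quotient.
(* If the image of [x] had order at most 4, then the involution [x ^+ 4] would lie in [<[w]>] and
   equal [w], putting [w] in [<[x]>]. *)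
- have o4 : #[x ^+ 4]%g = 2%N by rewrite orderXdiv ox.
  have : (#[coset <[w]> x]%g %| 2 ^ 3)%N.
    by rewrite order_dvdn -morphX ?(subsetP nwB) //= -[(2 ^ 3)%N]ox expg_order morph1.
  case/(dvdn_pfactor _ _ (isT : prime 2)) => i lei oi; rewrite oi.
  suff : ~~ (i <= 2)%N by case: i lei {oi} => [|[|[|[|]]]].
  apply: contraL nxw => lei2; rewrite negbK.
  have : (coset <[w]> x ^+ 4 == 1)%g.
    by rewrite -order_dvdn oi (dvdn_exp2l 2 lei2).
  rewrite -morphX ?(subsetP nwB) //= (coset_eq1E abB swB (groupX 4 Bx)) mem_cycle2 //.
  rewrite -order_eq1 o4 /= => /eqP <-; exact: mem_cycle.
have [f [phi' [perf phiK fouK]]] :=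
  perfect_step abK sBK iBK Kg nBg Bw ow perf1 rel2 phiB fou.
exists f, phi'; split=> //; rewrite fouK mulrA -natrM; congr (_%:R * _).
by rewrite expnS mulnCA.
Qed.

(* gam = omega * beta^2 has gam + gam^-1 = -2/3, which is not an algebraic
   integer. *)
Lemma beta_non_root m : (0 < m)%N -> beta omega zeta ^+ m != 1.
Proof.
move=> m_gt0; apply/eqP => bm.
have omega3 := cube_root_one omega_eq.
(* Since omega * (1 - omega^2)^2 = -3, this element lies in Q(zeta + zeta^3) = Q(sqrt(-2)), where it
   is (-1 - 2 * (zeta + zeta^3)) / 3. *)
pose gam := omega * beta omega zeta ^+ 2.
have gamE : gam = (-1 - 2%:R * (zeta + zeta ^+ 3)) / 3%:R.
  have o2 : omega ^+ 2 = - 1 - omega.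
    by apply/eqP; rewrite -subr_eq0 -omega_eq; apply/eqP; ring.
  have o2' : omega ^+ 2 * omega = 1 by rewrite -exprSr omega3.
  have -> : gam = (omega * (1 - omega ^+ 2) ^+ 2) *
      (zeta ^+ 2 * (zeta ^+ 4 + 1 - zeta ^+ 2 + 2%:R * zeta - 2%:R * zeta ^+ 3)) / 9%:R.
    by rewrite /gam /beta; field.
  rewrite zeta_eq.
  have -> : omega * (1 - omega ^+ 2) ^+ 2 = - 3%:R.
    have -> : omega * (1 - omega ^+ 2) ^+ 2 =
      omega - 2%:R * omega ^+ 3 + omega ^+ 3 * omega ^+ 2 by ring.
    by rewrite omega3 o2; ring.
  have -> : zeta ^+ 2 * (-1 + 1 - zeta ^+ 2 + 2%:R * zeta - 2%:R * zeta ^+ 3) =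
     - zeta ^+ 4 + 2%:R * zeta ^+ 3 - 2%:R * zeta ^+ 4 * zeta by ring.
  by rewrite zeta_eq; field.
have gam_root : gam ^+ (3 * m) = 1.
  rewrite exprMn (exprM omega) omega3 expr1n mul1r -exprM mulnA mulnC exprM bm.
  exact: expr1n.
have nu_gam : gam != 0.
  by apply: contra_eq_neq gam_root => ->; rewrite expr0n muln_eq0 /= eqn0Ngt m_gt0 eq_sym oner_eq0.
have Agam : gam \in Aint.
  by apply: (@Aint_unity_root (3 * m)); rewrite ?muln_gt0 // unity_rootE gam_root.
have Agam' : gam^-1 \in Aint.
  by apply: (@Aint_unity_root (3 * m)); rewrite ?muln_gt0 // unity_rootE exprVn gam_root invr1.
have gamV : gam^-1 = (-1 + 2%:R * (zeta + zeta ^+ 3)) / 3%:R.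
  apply: (mulfI nu_gam); rewrite mulfV // gamE.
  have -> : (-1 - 2%:R * (zeta + zeta ^+ 3)) / 3%:R *
    ((-1 + 2%:R * (zeta + zeta ^+ 3)) / 3%:R) =
    (1 - 4%:R * (zeta ^+ 2 + 2%:R * zeta ^+ 4 + zeta ^+ 4 * zeta ^+ 2)) / 9%:R by field.
  by rewrite zeta_eq; field.
have sumE : gam + gam^-1 = - 2%:R / 3%:R by rewrite gamV gamE; field.
have : gam + gam^-1 \in Num.int.
  apply: Cint_rat_Aint; last exact: rpredD.
  by rewrite sumE; apply: rpred_div; rewrite ?rpredN rpred_nat.
rewrite sumE => /intrP[z zE].
have : (3 * z)%:~R = (- 2)%:~R :> algC by rewrite intrM -zE; field.
by move/eqP; rewrite eqr_int => /eqP; lia.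
Qed.

End NonNaiveExists.

(** * From perfect functions to difference sets *)

Section LinearCharacters.

Variables (gT : finGroupType) (G : {group gT}).

Lemma char_on_lin_char (phi : gT -> algC) : char_on G phi ->
  exists2 chi : 'CF(G), chi \is a linear_char & {in G, chi =1 phi}.
Proof.
case=> phi1 phiM.
have repr_phi : mx_repr G (fun x => (phi x)%:M : 'M[algC]_1).
  by split=> [|x y Gx Gy]; rewrite ?phi1 // phiM //= scalar_mxM.
pose rG := MxRepresentation repr_phi.
have chiE : {in G, cfRepr rG =1 phi}.
  by move=> x Gx; rewrite cfunE Gx mulr1n /= mxtrace_scalar.
exists (cfRepr rG) => //; rewrite qualifE /= cfRepr_char.
by rewrite cfRepr1 eqxx.
Qed.

Lemma sum_lin_char (chi : 'CF(G)) : chi \is a linear_char -> chi != 1 ->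
  \sum_(g in G) chi g = 0.
Proof.
move=> chi_lin; have /irrP[i chiE] := lin_char_irr chi_lin.
rewrite {}chiE -irr0 (inj_eq irr_inj) => ni0.
have := cfdot_irr i 0; rewrite (negPf ni0) cfdotE => /eqP.
rewrite mulf_eq0 invr_eq0 (negPf (neq0CG G)) => /= /eqP sum0.
rewrite -[RHS]sum0; apply: eq_bigr => g Gg.
by rewrite irr0 cfun1E Gg conjC1 mulr1.
Qed.

End LinearCharacters.

Lemma Z33_comm (gT : finGroupType) : abelian [set: gT] -> abelian [set: Z33 * gT].
Proof.
move=> abG; apply/centsP=> -[[i j] x] _ [[k l] y] _.
congr ((_, _), _); try exact: Zp_mulgC.
by apply: (centsP abG); rewrite inE.
Qed.

(** The indicator of the set where [f] is -1 is (1 - f) / 2, so its size and difference counts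
    follow from the sum and the autocorrelation of [f]. *)
Lemma HDS_perfect (gT : finGroupType) (f : Z33 -> gT -> int) (u : nat) :
  abelian [set: gT] -> perfect [set: gT] f -> (9 * #|gT| = 4 * u ^ 2)%N ->
  \sum_z \sum_x f z x = (2 * u)%:R ->
  HDS u [set p : Z33 * gT | f p.1 p.2 == -1].
Proof.
move=> abG [sq corrf] cardG sumf; set D := [set p | _].
have f_pm z x : (f z x == -1)%:R *+ 2 = 1 - f z x :> int.
  have /eqP := sq z x (in_setT x).
  by rewrite sqrf_eq1 => /orP[] /eqP ->.
have cardT : #|[set: Z33 * gT]| = (4 * u ^ 2)%N.
  by rewrite cardsT card_prod cardZ33.
have leu : (u <= u ^ 2)%N.
  by have [->|u_gt0] := posnP u; rewrite // -mulnn leq_pmulr.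
have comm (p q : Z33 * gT) : (p * q = q * p)%g.
  by apply: (centsP (Z33_comm abG)); rewrite inE.
have sum_pair (F : Z33 * gT -> int) : \sum_p F p = \sum_z \sum_x F (z, x).
  by rewrite pair_bigA; apply: eq_bigr => [[]].
have sum1 : \sum_(p : Z33 * gT) (1 : int) = (4 * u ^ 2)%:R.
  by rewrite sumr_const -cardT cardsT.
have sumf' : \sum_(p : Z33 * gT) f p.1 p.2 = (2 * u)%:R by rewrite sum_pair.
split=> //.
  have : (#|D| * 2)%:R = (4 * u ^ 2)%:R - (2 * u)%:R :> int.
    rewrite -sum1 -sumf' -sumrB natrM -sum1_card natr_sum big_mkcond mulr_suml.
    by apply: eq_bigr => p _; rewrite inE -f_pm mulr_natr; case: eqP.
  by rewrite !natz; move: leu; move: #|D| (u ^ 2)%N => m v; lia.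
case=> a t nt1.
have -> : #|[set p : Z33 * gT * (Z33 * gT) |
    [&& p.1 \in D, p.2 \in D & (p.1 * p.2^-1 == (a, t))%g]]| =
    (\sum_(q : Z33 * gT) ((q \in D) * ((q * (a, t))%g \in D)))%N.
  rewrite (eq_bigr (fun q => ((q \in D) && ((q * (a, t))%g \in D) : nat))); last first.
    by move=> q _; rewrite mulnb.
  rewrite -big_mkcond /= sum1_card.
  rewrite -(card_imset _ (_ : injective (fun q => ((q * (a, t))%g, q)))); last first.
    by move=> q r [].
  apply: eq_card => -[p q]; rewrite !inE /=; apply/and3P/imsetP.
    case=> Dp Dq /eqP pq; have pE : (q * (a, t))%g = p by rewrite -pq comm mulKVg.
    by exists q; [rewrite unfold_in /= pE !inE Dq Dp | rewrite pE].
  case=> r; rewrite unfold_in /= !inE => /andP[Dr Dra] [-> ->]; split=> //.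
  by rewrite comm mulKg.
have corr0 : \sum_(q : Z33 * gT) f q.1 q.2 * f (q * (a, t))%g.1 (q * (a, t))%g.2 = 0.
  rewrite sum_pair; have := corrf a t (in_setT t).
  have -> : (a == 1%g) && (t == 1%g) = false by apply/negbTE.
  rewrite mulr0 => corr0; rewrite -[RHS]corr0; apply: eq_bigr => z _.
  by apply: eq_bigl => x; rewrite inE.
have sumfg : \sum_(q : Z33 * gT) f (q * (a, t))%g.1 (q * (a, t))%g.2 = (2 * u)%:R.
  by rewrite -sumf' [RHS](reindex_inj (mulIg (a, t))).
set n := (\sum_q _)%N.
(* Expand (1 - f q) times (1 - f (q * (a, t))), which is 4 at the counted points and 0 elsewhere;
   the product term is the vanishing autocorrelation. *)
have : (n * 4)%:R = (4 * u ^ 2)%:R - (2 * u)%:R - (2 * u)%:R + 0 :> int.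
  rewrite -[in RHS]sum1 -[X in _ - X - _ + _]sumf' -[X in _ - X + _]sumfg.
  rewrite -[X in _ = _ + X]corr0 -!sumrB -big_split natrM natr_sum mulr_suml.
  apply: eq_bigr => q _ /=; rewrite !inE natrM.
  have E1 := f_pm q.1 q.2; have E2 := f_pm (q * (a, t))%g.1 (q * (a, t))%g.2.
  move: E1 E2; set b1 := _%:R; set b2 := _%:R => E1 E2.
  have -> : b1 * b2 * 4 = b1 *+ 2 * (b2 *+ 2) by ring.
  by rewrite E1 E2; ring.
by rewrite !natz; move: leu; move: (u ^ 2)%N => v; clearbody n; clear; lia.
Qed.

(** Summing the autocorrelation over all shifts gives the square of the sum. This fixes the sum up
    to sign, as [HDS_perfect] needs. *)
Lemma perfect_sum_sq (gT : finGroupType) (f : Z33 -> gT -> int) :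
  perfect [set: gT] f -> (\sum_z \sum_x f z x) ^+ 2 = (9 * #|gT|)%:R.
Proof.
case=> _ corrf; set s := \sum_z _.
have <- : \sum_a \sum_t corr [set: gT] f f a t = (9 * #|gT|)%:R.
  rewrite (bigD1 1%g) //= (bigD1 1%g) //= big1 => [|t nt1]; last first.
    by rewrite corrf // (negPf nt1) andbF mulr0.
  rewrite big1 => [|a na1]; last first.
    by apply: big1 => t _; rewrite corrf // (negPf na1) mulr0.
  by rewrite corrf // !eqxx mulr1 !addr0 cardZ33 cardsT.
rewrite expr2 {1}/s mulr_suml /corr; symmetry.
under eq_bigr => a _ do rewrite exchange_big /=.
rewrite exchange_big /=; apply: eq_bigr => z _.
under eq_bigr => a _ do rewrite exchange_big /=.
rewrite exchange_big mulr_suml /=.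
rewrite (eq_bigl predT) => [|x]; last by rewrite inE.
apply: eq_bigr => x _; rewrite /s mulr_sumr [RHS](reindex_inj (mulgI z)) /=.
apply: eq_bigr => a _; rewrite mulr_sumr [RHS](reindex_inj (mulgI x)) /=.
by [].
Qed.

Lemma perfect_opp (gT : finGroupType) (K : {set gT}) (f : Z33 -> gT -> int) :
  perfect K f -> perfect K (fun z x => - f z x).
Proof.
case=> sq corrf; split=> [z x Kx|a t Kt]; first by rewrite sqrrN sq.
rewrite -corrf // /corr; apply: eq_bigr => z _; apply: eq_bigr => x _.
by rewrite mulrNN.
Qed.

Lemma psi_char omega : 1 + omega + omega ^+ 2 = 0 ->
  char_on [set: Z33] (psi omega).
Proof.
move=> omega_eq; have omega3 := cube_root_one omega_eq.
split=> [|[i j] [k l] _ _] /=; first by rewrite /psi /= expr0.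
by rewrite /psi /= -exprD -[RHS](expr_mod _ omega3).
Qed.

Lemma non_naive_HDS_exists (d : nat) (H : finGroupType) : (0 < d)%N ->
  abelian [set: H] -> #|[set: H]| = (2 ^ (2 * d + 2))%N ->
  (8 <= exponent [set: H] <= 2 ^ (d + 2))%N ->
  exists D : {set Z33 * H}, non_naive_HDS (3 * 2 ^ d) D.
Proof.
case: d => // e _ abH cardH /andP[le8 leexp].
have pH : (2.-group [set: H])%g by rewrite /pgroup cardH pnatX pnat_id ?orbT.
have [y _ expE] := exponent_witness (abelian_nil abH).
have : (#[y]%g %| 2 ^ (2 * e.+1 + 2))%N by rewrite -cardH order_dvdG ?inE.
case/(dvdn_pfactor _ _ (isT : prime 2)) => a _ oy.
have le3a : (3 <= a)%N by rewrite -(@leq_exp2l 2) // -oy -expE.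
have lea : (a <= e.+1 + 2)%N by rewrite -(@leq_exp2l 2) // -oy -expE.
(* An element of order 8 exists because the exponent 2^a is at least 8; it starts the induction. *)
pose x := (y ^+ (2 ^ (a - 3)))%g.
have ox : #[x]%g = 8%N.
  rewrite orderXdiv oy ?dvdn_exp2l ?leq_subr // -expnB ?leq_subr //.
  by rewrite subKn.
have expH : {in [set: H], forall v, v ^+ (2 ^ e.+3) = 1}%g.
  move=> v _; apply/eqP; rewrite -order_dvdn.
  apply: dvdn_trans (dvdn_exponent (in_setT v)) _.
  by rewrite expE oy dvdn_exp2l // (leq_trans lea) // addn2.
have [omega omega_eq _] := cube_root_exists.
have [zeta zeta_prim] := C_prim_root_exists (isT : (0 < 8)%N).
have zeta_eq : zeta ^+ 4 = -1.
  have : (zeta ^+ 4) ^+ 2 == 1 by rewrite -exprM (prim_expr_order zeta_prim).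
  rewrite sqrf_eq1 => /orP[|/eqP //].
  by rewrite -[1](expr0 zeta) (eq_prim_root_expr zeta_prim).
have cardH' : #|[set: H]%G| = (2 ^ (2 * e + 4))%N by rewrite cardH; congr (_ ^ _)%N; lia.
have [f [phi [perf phi_ch fou]]] :=
  non_naive_perfect_exists omega_eq zeta_eq abH cardH' expH (in_setT x) ox.
set u := (3 * 2 ^ e.+1)%N.
have u_gt0 : (0 < u)%N by rewrite muln_gt0 expn_gt0.
have card4u : (9 * #|H| = 4 * u ^ 2)%N.
  rewrite -cardsT cardH' /u expnMn -expnM (_ : e.+1 * 2 = 2 * e + 2)%N; last by lia.
  rewrite (_ : 2 * e + 4 = (2 * e + 2) + 2)%N; last by lia.
  by rewrite expnD; move: (2 ^ (2 * e + 2))%N => P; lia.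
pose b := beta omega zeta.
(* Choose the sign of the function so that its sum is +2u; [c] records this sign in the character
   value. *)
have [f' [c [perf' sumf' c2 fou']]] : exists f' (c : algC),
    [/\ perfect [set: H] f', \sum_z \sum_x f' z x = (2 * u)%:R, c ^+ 2 = 1
      & fourier [set: H] (psi omega) phi f' = (2 * u)%:R * (c * b)].
  have uE : (12 * 2 ^ e = 2 * u)%N by rewrite /u expnS; lia.
  have := perfect_sum_sq perf; rewrite card4u (_ : 4 * u ^ 2 = (2 * u) ^ 2)%N; last by rewrite expnMn.
  rewrite natrX => /eqP; rewrite eqf_sqr => /orP[]/eqP sumf.
    by exists f, 1; split; rewrite ?expr1n // fou uE mul1r.
  exists (fun z x => - f z x), (-1); split; first exact: perfect_opp.
  - rewrite -[RHS]opprK -sumf -sumrN; apply: eq_bigr => z _; exact: sumrN.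
  - by rewrite sqrrN expr1n.
  rewrite mulN1r mulrN -uE -fou /fourier -sumrN; apply: eq_bigr => z _.
  by rewrite -sumrN; apply: eq_bigr => v _; rewrite rmorphN mulrN.
exists [set p : Z33 * H | f' p.1 p.2 == -1]; split.
  exact: HDS_perfect.
set D := [set p | _].
have [psi1 psiM] := psi_char omega_eq; have [phi1 phiM] := phi_ch.
have chi_ch : char_on [set: Z33 * H] (fun p => psi omega p.1 * phi p.2).
  split=> [|p q _ _] /=; first by rewrite psi1 phi1 mulr1.
  by rewrite psiM ?inE // phiM ?inE // mulrACA.
have [chi chi_lin chiE] := char_on_lin_char chi_ch.
have fourE : fourier [set: H] (psi omega) phi f' =
    \sum_(p : Z33 * H) chi p * (f' p.1 p.2)%:~R.
  rewrite /fourier pair_big /=.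
  by apply: eq_big => [p|p _]; rewrite ?inE // chiE ?inE.
have b_root m : (0 < m)%N -> (c * b) ^+ m != 1.
  move=> m_gt0; apply/eqP => cb.
  have m2 : (0 < 2 * m)%N by rewrite muln_gt0.
  have /eqP[] := beta_non_root omega_eq zeta_eq m2.
  have : ((c * b) ^+ m) ^+ 2 = 1 by rewrite cb expr1n.
  by rewrite -exprM mulnC exprM [(c * b) ^+ 2]exprMn c2 mul1r -exprM.
have u0 : (2 * u)%:R != 0 :> algC by rewrite pnatr_eq0 -lt0n muln_gt0.
case=> _ naiveD.
have chi1 : chi != 1.
  apply/eqP => chi1; have /eqP[] := b_root 1%N isT.
  rewrite expr1; apply: (mulfI u0); rewrite -fou' fourE mulr1.
  rewrite -[(2 * u)%:R](rmorph_nat (intmul 1)) -sumf' pair_big rmorph_sum /=.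
  by apply: eq_bigr => p _; rewrite chi1 cfun1E inE mul1r.
have [m [w [m_gt0 wm Dw]]] := naiveD chi chi_lin chi1.
have m2 : (0 < 2 * m)%N by rewrite muln_gt0.
have /eqP[] := b_root _ m2.
(* The sum of a nontrivial character over the group vanishes, so the character sum of [f'] is -2
   times that of [D]. Doubling the exponent [m] absorbs the sign. *)
suff -> : c * b = - w by rewrite exprM sqrrN -exprM mulnC exprM wm expr1n.
apply: (mulfI u0); rewrite -fou' fourE.
have -> : \sum_p chi p * (f' p.1 p.2)%:~R = \sum_p chi p - 2%:R * char_sum chi D.
  rewrite /char_sum [X in _ - _ * X]big_mkcond mulr_sumr -sumrB; apply: eq_bigr => p _.
  rewrite inE; case: perf' => sq _; have /eqP := sq p.1 p.2 (in_setT _).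
  by rewrite sqrf_eq1 => /orP[]/eqP->; rewrite /= ?mulr1 ?mulr0 ?subr0 //; ring.
have -> : \sum_p chi p = \sum_(p in [set: Z33 * H]) chi p.
  by apply: eq_bigl => p; rewrite inE.
by rewrite sum_lin_char // Dw natrM; ring.
Qed.

(** * Exponent at most 4 *)

(** Group the double sum by differences: the identity contributes k, every other element lambda, and
    the nontrivial character sums to -1 off the identity. The result is k - lambda = u^2. *)
Lemma HDS_char_norm (gT : finGroupType) (u : nat) (D : {set gT})
    (chi : 'CF([set: gT])) : HDS u D -> chi \is a linear_char -> chi != 1 ->
  char_sum chi D * (char_sum chi D)^* = (u ^ 2)%:R.
Proof.
case=> cardT cardD diffD chi_lin nchi1.
pose n g := #|[set p : gT * gT | [&& p.1 \in D, p.2 \in D & (p.1 * p.2^-1 == g)%g]]|.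
have -> : char_sum chi D * (char_sum chi D)^* = \sum_(g in [set: gT]) (n g)%:R * chi g.
  rewrite /char_sum rmorph_sum big_distrlr /= pair_big /=.
  rewrite (partition_big (fun p => p.1 * p.2^-1)%g predT) //=.
  apply: eq_big => [g|g _]; first by rewrite inE.
  rewrite (eq_bigr (fun=> chi g)).
    rewrite sumr_const mulr_natl; congr (_ *+ _); apply: eq_card => p.
    by rewrite inE unfold_in /= -andbA.
  move=> p /andP[_ /eqP <-].
  by rewrite lin_charM ?inE // -lin_charV_conj ?inE.
rewrite (bigD1 1%g) ?inE //= lin_char1 // mulr1.
have -> : n 1%g = (2 * u ^ 2 - u)%N.
  rewrite -cardD /n -(card_imset D (_ : injective (fun x : gT => (x, x)))).
    apply: eq_card => -[p q]; rewrite !inE /= -eq_mulgV1.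
    apply/and3P/imsetP=> [[Dp _ /eqP <-]|[x Dx [-> ->]]]; last by split.
    by exists p.
  by move=> x y [].
rewrite (eq_bigr (fun g => (u ^ 2 - u)%:R * chi g)) => [|g /andP[_ g1]]; last first.
  by rewrite /n diffD.
have := sum_lin_char chi_lin nchi1; rewrite (bigD1 1%g) ?inE //= lin_char1 //.
rewrite -mulr_sumr => /eqP; rewrite addrC addr_eq0 => /eqP ->.
have leu : (u <= u ^ 2)%N.
  by have [->|u_gt0] := posnP u; rewrite // -mulnn leq_pmulr.
rewrite !natrB //; last by apply: leq_trans leu _; rewrite leq_pmull.
by rewrite natrM; ring.
Qed.

Section TwelfthRoots.

Variable omega : algC.
Hypotheses (omega_eq : 1 + omega + omega ^+ 2 = 0) (omega_conj : omega^* = omega ^+ 2).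

Let omega2 : omega ^+ 2 = - 1 - omega.
Proof. by apply/eqP; rewrite -subr_eq0 -omega_eq; apply/eqP; ring. Qed.

Let omega3 : omega ^+ 3 = 1 := cube_root_one omega_eq.

(** Elements of Z[i, omega], the ring of integers of the 12th cyclotomic field, in the basis 1, i,
    omega, i * omega. *)
Definition gauss_eisenstein (a b c e : int) : algC :=
  a%:~R + b%:~R * 'i + (c%:~R + e%:~R * 'i) * omega.

Let inGE (x : algC) := exists a b c e, x = gauss_eisenstein a b c e.

Let inGE_add x y : inGE x -> inGE y -> inGE (x + y).
Proof.
case=> [a [b [c [e ->]]]] [a' [b' [c' [e' ->]]]].
exists (a + a'), (b + b'), (c + c'), (e + e').
by rewrite /gauss_eisenstein !rmorphD /=; ring.
Qed.

Let inGE_mul x y : inGE x -> inGE y -> inGE (x * y).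
Proof.
case=> [a [b [c [e ->]]]] [a' [b' [c' [e' ->]]]].
exists (a * a' - b * b' - (c * c' - e * e')), (a * b' + b * a' - (c * e' + e * c')),
  (a * c' - b * e' + c * a' - e * b' - (c * c' - e * e')),
  (a * e' + b * c' + c * b' + e * a' - (c * e' + e * c')).
rewrite /gauss_eisenstein !(rmorphD, rmorphB, rmorphM, rmorphN) /=.
have ii : 'i * 'i = -1 :> algC by rewrite -expr2 sqrCi.
have oo : omega * omega = - 1 - omega by rewrite -expr2.
ring: ii oo.
Qed.

Let inGE_int (n : int) : inGE n%:~R.
Proof. by exists n, 0, 0, 0; rewrite /gauss_eisenstein; ring. Qed.

Let inGE_i : inGE 'i.
Proof. by exists 0, 1, 0, 0; rewrite /gauss_eisenstein; ring. Qed.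

Let inGE_omega : inGE omega.
Proof. by exists 0, 0, 1, 0; rewrite /gauss_eisenstein; ring. Qed.

Let inGE_root12 z : z ^+ 12 = 1 -> inGE z.
Proof.
(* z = z^13 is the product of the cube root of unity z^4 and the fourth root of unity z^9. *)
move=> z12; have -> : z = z ^+ 4 * z ^+ 9 by rewrite -exprD (exprD _ 12 1) z12 mul1r.
have N1 : inGE (-1) := inGE_int (-1).
apply: inGE_mul.
  have : (z ^+ 4 - 1) * (z ^+ 4 - omega) * (z ^+ 4 - omega ^+ 2) = 0.
    have -> : (z ^+ 4 - 1) * (z ^+ 4 - omega) * (z ^+ 4 - omega ^+ 2) =
      z ^+ 12 - (z ^+ 4) ^+ 2 * (1 + omega + omega ^+ 2) +
      z ^+ 4 * omega * (1 + omega + omega ^+ 2) - omega ^+ 3 by ring.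
    by rewrite omega_eq omega3 z12; ring.
  move/eqP; rewrite !mulf_eq0 -orbA !subr_eq0 => /or3P[]/eqP-> //.
    exact: (inGE_int 1).
  by rewrite expr2; apply: inGE_mul.
have : (z ^+ 9 - 1) * (z ^+ 9 + 1) * (z ^+ 9 - 'i) * (z ^+ 9 + 'i) = 0.
  have -> : (z ^+ 9 - 1) * (z ^+ 9 + 1) * (z ^+ 9 - 'i) * (z ^+ 9 + 'i) =
    ((z ^+ 12) ^+ 3 - (z ^+ 9) ^+ 2) - 'i ^+ 2 * ((z ^+ 9) ^+ 2 - 1) by ring.
  by rewrite z12 sqrCi; ring.
move/eqP; rewrite !mulf_eq0 -!orbA !subr_eq0 !addr_eq0.
case/or4P => /eqP-> //; first exact: (inGE_int 1).
by rewrite -mulN1r; apply: inGE_mul.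
Qed.

(* The norm is Q - t * sqrt 3 with Q and t integers, so t = 0. *)
Lemma gauss_eisenstein_norm a b c e (N : int) :
  gauss_eisenstein a b c e * (gauss_eisenstein a b c e)^* = N%:~R ->
  a * e = b * c /\ a ^+ 2 + b ^+ 2 + c ^+ 2 + e ^+ 2 - a * c - b * e = N.
Proof.
pose Q := a ^+ 2 + b ^+ 2 + c ^+ 2 + e ^+ 2 - a * c - b * e.
pose t := b * c - a * e.
pose delta := 'i * (1 + 2%:R * omega).
have d3 : delta ^+ 2 = 3%:R.
  have -> : delta ^+ 2 = 'i ^+ 2 * (1 + 4%:R * omega + 4%:R * omega ^+ 2).
    by rewrite /delta; ring.
  by rewrite sqrCi omega2; ring.
have -> : gauss_eisenstein a b c e * (gauss_eisenstein a b c e)^* =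
    Q%:~R - t%:~R * delta.
  have cint (n : int) : (n%:~R : algC)^* = n%:~R by rewrite rmorph_int.
  rewrite /gauss_eisenstein /delta /Q /t !(rmorphD, rmorphM, rmorphB, rmorphN, rmorphXn) /=.
  rewrite !cint conjCi omega_conj omega2.
  have ii : 'i * 'i = -1 :> algC by rewrite -expr2 sqrCi.
  have oo : omega * omega = - 1 - omega by rewrite -expr2.
  ring: ii oo.
move=> E; have : ((Q - N) ^+ 2)%:~R = (3 * t ^+ 2)%:~R :> algC.
  have -> : ((Q - N) ^+ 2)%:~R = (t%:~R * delta) ^+ 2 :> algC.
    by rewrite rmorphXn rmorphB /= -E; congr (_ ^+ 2); ring.
  by rewrite exprMn d3 rmorphM rmorphXn /=; ring.
move/eqP; rewrite eqr_int => /eqP sq3.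
have t0 : t = 0.
  apply/eqP; rewrite -absz_eq0 -leqn0 leqNgt; apply/negP => t_gt0.
  have E3 : (`|Q - N| ^ 2 = 3 * `|t| ^ 2)%N by rewrite -!abszX sq3 abszM.
  (* Irrationality of sqrt 3: the two sides of [E3] would have 3-adic valuations of different
     parity. *)
  have : odd (logn 3 (`|Q - N| ^ 2)) = ~~ odd (logn 3 (`|t| ^ 2)).
    by rewrite E3 lognM ?expn_gt0 ?t_gt0.
  by rewrite !lognX !mul2n !odd_double.
have QN : Q = N.
  by apply/eqP; rewrite -subr_eq0 -sqrf_eq0 sq3 t0 expr2 mulr0.
by split; [rewrite /t in t0; lia | exact: QN].
Qed.

(** If exactly one of the pairs (a, c) and (b, e) is even, the form is odd. If neither is, a * e = b
    * c makes them equal modulo 2, and the form is then 2 modulo 4. *)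
Lemma even_descent (a b c e N : int) : a * e = b * c ->
  a ^+ 2 + b ^+ 2 + c ^+ 2 + e ^+ 2 - a * c - b * e = 4 * N ->
  exists a' b' c' e', [/\ a = 2 * a', b = 2 * b', c = 2 * c' & e = 2 * e'].
Proof.
have par (n : int) : exists m, n = 2 * m \/ n = 2 * m + 1.
  by exists (n %/ 2)%Z; lia.
have [a' [->|->]] := par a; have [b' [->|->]] := par b;
  have [c' [->|->]] := par c; have [e' [->|->]] := par e;
  rewrite !expr2 => E Q; try (exfalso; lia).
by exists a', b', c', e'.
Qed.

(** The form is positive definite: completing squares gives 3 * n^2 <= 36 for each coordinate, and a
    finite check leaves the twelve elements 3 * w with [w] a twelfth root of unity. *)
Lemma norm9 (a b c e : int) : a * e = b * c ->
    a ^+ 2 + b ^+ 2 + c ^+ 2 + e ^+ 2 - a * c - b * e = 9 ->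
  exists2 w, w ^+ 12 = 1 & gauss_eisenstein a b c e = 3%:R * w.
Proof.
pose range := [:: -3; -2; -1; 0; 1; 2; 3 : int].
pose sols : seq (int * int * int * int) := [:: (3, 0, 0, 0); (-3, 0, 0, 0); (0, 3, 0, 0); (0, -3, 0, 0);
  (0, 0, 3, 0); (0, 0, -3, 0); (0, 0, 0, 3); (0, 0, 0, -3);
  (3, 0, 3, 0); (-3, 0, -3, 0); (0, 3, 0, 3); (0, -3, 0, -3)].
have /allP check : all (fun a => all (fun b => all (fun c => all (fun e =>
    ((a * e == b * c) &&
     (a ^+ 2 + b ^+ 2 + c ^+ 2 + e ^+ 2 - a * c - b * e == 9)) ==>
    ((a, b, c, e) \in sols)) range) range) range) range by vm_compute.
move=> E Q.
have in_range n m k l : n ^+ 2 + m ^+ 2 - n * m + (k ^+ 2 + l ^+ 2 - k * l) = 9 ->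
    n \in range.
  move=> nm.
  have E36 : 3 * n ^+ 2 + ((2 * m - n) ^+ 2 + (2 * k - l) ^+ 2 + 3 * l ^+ 2) = 36.
    by rewrite (_ : 36 = 4 * 9) // -nm; ring.
  have : (`|n| ^ 2 <= 12)%N.
    have := sqr_ge0 (2 * m - n); have := sqr_ge0 (2 * k - l); have := sqr_ge0 l.
    have := sqr_ge0 n; move: E36; rewrite -abszX.
    move: (n ^+ 2) ((2 * m - n) ^+ 2) ((2 * k - l) ^+ 2) (l ^+ 2) => A B C D.
    by clear; lia.
  move=> n12; have : (`|n| < 4)%N.
    by rewrite ltnNge; apply/negP; rewrite -leq_sqr => /leq_trans/(_ n12).
  by case: n {nm E36 n12} => [[|[|[|[|]]]]|[|[|[|]]]].
have ra : a \in range by apply: (in_range a c b e); rewrite -Q; ring.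
have rb : b \in range by apply: (in_range b e a c); rewrite -Q; ring.
have rc : c \in range by apply: (in_range c a b e); rewrite -Q; ring.
have re : e \in range by apply: (in_range e b a c); rewrite -Q; ring.
move: (check a ra) => /allP/(_ b rb)/allP/(_ c rc)/allP/(_ e re).
rewrite E Q !eqxx implyTb !inE => sol.
have i12 : 'i ^+ 12 = 1 :> algC by rewrite (exprM _ 2 6) sqrCi; ring.
have o12 : omega ^+ 12 = 1 by rewrite (exprM _ 3 4) omega3 expr1n.
have n12 (x : algC) : (- x) ^+ 12 = x ^+ 12 by rewrite exprNn; ring.
have oS : omega ^+ 2 = - 1 - omega := omega2.
have root w : (w \in [:: 1; 'i; omega; 'i * omega; omega ^+ 2; 'i * omega ^+ 2]) ->
    w ^+ 12 = 1 /\ (- w) ^+ 12 = 1.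
  rewrite n12 !inE => /orP[|/orP[|/orP[|/orP[|/orP[]]]]] /eqP->;
  by rewrite ?exprMn -?exprM ?(exprM omega 12 2) ?i12 ?o12 ?expr1n ?mulr1.
have [r1 r1'] := root 1 (mem_head _ _).
have [r2 r2'] := root 'i (ltac:(by rewrite !inE eqxx ?orbT)).
have [r3 r3'] := root omega (ltac:(by rewrite !inE eqxx ?orbT)).
have [r4 r4'] := root ('i * omega) (ltac:(by rewrite !inE eqxx ?orbT)).
have [r5 r5'] := root (omega ^+ 2) (ltac:(by rewrite !inE eqxx ?orbT)).
have [r6 r6'] := root ('i * omega ^+ 2) (ltac:(by rewrite !inE eqxx ?orbT)).
rewrite /gauss_eisenstein; rewrite oS in r5 r5' r6 r6'.
move: sol; do 11?[case/orP]; move=> /eqP[-> -> -> ->].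
- by exists 1 => //; ring.
- by exists (- 1) => //; ring.
- by exists 'i => //; ring.
- by exists (- 'i) => //; ring.
- by exists omega => //; ring.
- by exists (- omega) => //; ring.
- by exists ('i * omega) => //; ring.
- by exists (- ('i * omega)) => //; ring.
- by exists (- (- 1 - omega)) => //; ring.
- by exists (- 1 - omega) => //; ring.
- by exists (- ('i * (- 1 - omega))) => //; ring.
- by exists ('i * (- 1 - omega)) => //; ring.
Qed.

Lemma twelfth_root_sum_naive (d : nat) (I : finType) (D : {set I}) (chi : I -> algC) :
  (forall i, chi i ^+ 12 = 1) ->
  (\sum_(i in D) chi i) * (\sum_(i in D) chi i)^* = ((3 * 2 ^ d) ^ 2)%:R ->
  naive (3 * 2 ^ d) (\sum_(i in D) chi i).
Proof.
move=> chi12 norm; have [a [b [c [e ge]]]] : inGE (\sum_(i in D) chi i).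
  elim/big_rec: _ => [|i x _ inx]; first exact: (inGE_int 0).
  by apply: inGE_add => //; apply: inGE_root12.
rewrite ge in norm *.
have e36 : ((3 * 2 ^ d) ^ 2 = 9 * 4 ^ d)%N.
  by rewrite expnMn -[in LHS]expnM (mulnC d 2) expnM.
rewrite e36 in norm.
have {norm}[] := gauss_eisenstein_norm (N := (9 * 4 ^ d)%N) norm.
move=> E Q; have [w w12 ->] : exists2 w, w ^+ 12 = 1 &
    gauss_eisenstein a b c e = (3 * 2 ^ d)%:R * w.
  (* Each step halves all four coordinates, until the norm is 9. *)
  elim: d a b c e E Q {ge chi12 e36} => [|d IHd] a b c e E Q.
    by have [w w12 ->] := norm9 E Q; exists w.
  have [|a' [b' [c' [e' [Da Db Dc De]]]]] := even_descent (N := (9 * 4 ^ d)%N) E.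
    by rewrite Q expnS mulnCA PoszM.
  have [||w w12 gw] := IHd a' b' c' e'.
  - by move: E; rewrite Da Db Dc De; lia.
  - apply: (mulfI (isT : 4 != 0 :> int)).
    rewrite (_ : 4 * Posz (9 * 4 ^ d)%N = (9 * 4 ^ d.+1)%N); last first.
      by rewrite expnS mulnCA PoszM.
    by rewrite -Q Da Db Dc De; ring.
  exists w => //; rewrite expnS mulnCA natrM -mulrA -gw Da Db Dc De.
  by rewrite /gauss_eisenstein !rmorphM /=; ring.
by exists 12, w.
Qed.

End TwelfthRoots.

(** * The exponent bound *)

(* X is a set of characters, S a ring of functions on X, and y the evaluation at
   an element of order 2^(s+1); 1 - y is a uniformizer above 2. *)
Section TwoAdicDescent.

Variables (X : Type) (S : (X -> algC) -> Prop).
Hypothesis S_ext : forall x y, (forall i, x i = y i) -> S x -> S y.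
Hypothesis S1 : S (fun=> 1).
Hypothesis SB : forall x y, S x -> S y -> S (fun i => x i - y i).
Hypothesis SM : forall x y, S x -> S y -> S (fun i => x i * y i).
Hypothesis SC : forall x, S x -> S (fun i => (x i)^*).

Let S0 : S (fun=> 0).
Proof. by apply: S_ext (SB S1 S1) => i; rewrite subrr. Qed.

Let SD x y : S x -> S y -> S (fun i => x i + y i).
Proof. by move=> Sx Sy; apply: S_ext (SB Sx (SB S0 Sy)) => i; rewrite sub0r opprK. Qed.

Let SX x n : S x -> S (fun i => x i ^+ n).
Proof.
move=> Sx; elim: n => [|n IHn]; first by apply: S_ext S1 => i; rewrite expr0.
by apply: S_ext (SM Sx IHn) => i; rewrite exprS.
Qed.

Let S2 : S (fun=> 2%:R).
Proof. by apply: S_ext (SD S1 S1) => i; ring. Qed.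

Let S_geom x n : S x -> S (fun i => \sum_(j < n) x i ^+ j).
Proof.
move=> Sx; elim: n => [|n IHn]; first by apply: S_ext S0 => i; rewrite big_ord0.
by apply: S_ext (SD IHn (SX n Sx)) => i; rewrite big_ord_recr.
Qed.

(** Induction through y^2. As -1 is a power of y, 1 + y = 1 - y^(2^(s+1) + 1) is divisible by 1 - y,
    so (1 - y)^2 divides 1 - y^2. *)
Lemma two_dvd_unif s y : S y -> (forall i, y i ^+ (2 ^ s) = -1) ->
  exists2 mu, S mu & forall i, 2%:R = (1 - y i) ^+ (2 ^ s) * mu i.
Proof.
elim: s y => [|s IHs] y Sy yM.
  exists (fun=> 1) => // i; have := yM i; rewrite expn0 !expr1 => ->; ring.
have [|mu Smu muE] := IHs (fun i => y i ^+ 2) (SX 2 Sy).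
  by move=> i; rewrite -exprM -expnS yM.
exists (fun i => (\sum_(j < (2 ^ s.+1).+1) y i ^+ j) ^+ (2 ^ s) * mu i).
  exact: SM (SX _ (S_geom _ Sy)) Smu.
move=> i; rewrite (muE i) mulrA; congr (_ * _).
have -> : (1 - y i) ^+ (2 ^ s.+1) = ((1 - y i) ^+ 2) ^+ (2 ^ s) by rewrite -exprM -expnS.
rewrite -exprMn; congr (_ ^+ _).
have := subrX1 (y i) (2 ^ s.+1).+1; rewrite exprSr yM => E.
have -> : 1 - y i ^+ 2 = (1 - y i) * - (-1 * y i - 1) by ring.
by rewrite E; ring.
Qed.

(** Repeated squaring modulo 2. When y^(2^s) = -1 it says that 2 divides (1 - y)^(2^s), the converse
    of [two_dvd_unif]. *)
Lemma unif_pow_two s y : S y ->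
  exists2 q, S q & forall i, (1 - y i) ^+ (2 ^ s) = 1 + y i ^+ (2 ^ s) + 2%:R * q i.
Proof.
move=> Sy; elim: s => [|s [q Sq qE]].
  by exists (fun i => 0 - y i); [apply: SB | move=> i; rewrite expn0 !expr1; ring].
exists (fun i => y i ^+ (2 ^ s) + 2%:R * q i * (1 + y i ^+ (2 ^ s)) + 2%:R * (q i) ^+ 2).
  apply: SD; last exact: SM S2 (SX _ Sq).
  by apply: SD; [exact: SX | apply: SM; [exact: SM | apply: SD => //; exact: SX]].
by move=> i; rewrite expnSr !exprM qE; ring.
Qed.

Variables (y : X -> algC) (s : nat).
Hypotheses (Sy : S y) (y_unit : forall i, y i * (y i)^* = 1).
Hypothesis yM : forall i, y i ^+ (2 ^ s) = -1.
Hypothesis frob : forall x, S x ->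
  exists2 v, S v & forall i, (x i)^* = x i ^+ 2 + (1 - y i) * v i.

Let S_pi : S (fun i => 1 - y i). Proof. exact: SB. Qed.

Let pi_neq0 i : 1 - y i != 0.
Proof.
rewrite subr_eq0; apply/eqP => y1; have /eqP := yM i.
by rewrite -y1 expr1n -subr_eq0 opprK -mulr2n pnatr_eq0.
Qed.

(* Applying frob twice, x = x^4 = x * (x * x^* ) modulo 1 - y. *)
Lemma norm_dvd_unif x v : S x -> S v ->
  (forall i, x i * (x i)^* = (1 - y i) * v i) ->
  exists2 w, S w & forall i, x i = (1 - y i) * w i.
Proof.
move=> Sx Sv xv; have [a Sa aE] := frob Sx; have [b Sb bE] := frob (SC Sx).
exists (fun i => x i * v i + x i ^+ 2 * a i + (1 - y i) * a i ^+ 2 + b i).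
  apply: SD => //; apply: SD; last exact: SM S_pi (SX 2 Sa).
  by apply: SD; [exact: SM | exact: SM (SX 2 Sx) Sa].
move=> i; have xE : x i = (x i)^* ^+ 2 + (1 - y i) * b i by rewrite -bE conjCK.
rewrite [LHS]xE.
have -> : (1 - y i) * (x i * v i + x i ^+ 2 * a i + (1 - y i) * a i ^+ 2 + b i) =
  x i * ((1 - y i) * v i) + (1 - y i) * (x i ^+ 2 * a i + (1 - y i) * a i ^+ 2 + b i).
  by ring.
by rewrite -xv aE; ring.
Qed.

(** The conjugate of 1 - y is a unit times 1 - y, and 4^k is divisible by (1 - y)^(2kM). So
    [norm_dvd_unif] removes factors 1 - y from x one at a time, kM times in all, and (1 - y)^(kM) is
    a multiple of 2^k. *)
Lemma norm_dvd_pow2 x c k : S x -> S c ->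
  (forall i, x i * (x i)^* = 4%:R ^+ k * c i) ->
  exists2 v, S v & forall i, x i = 2%:R ^+ k * v i.
Proof.
move=> Sx Sc xc; set M := (2 ^ s)%N.
have [mu Smu muE] := two_dvd_unif Sy yM.
have [nu Snu nuE] := unif_pow_two s Sy.
have descent m : (m <= k * M)%N -> exists2 b, S b & forall i, x i = (1 - y i) ^+ m * b i.
  elim: m => [|m IHm] lem; first by exists x => // i; rewrite expr0 mul1r.
  have [b Sb bE] := IHm (ltnW lem).
  (* After [m] factors are removed, the norm retains 2 * (kM - m) = r + 1 factors 1 - y; one is
     split off for [norm_dvd_unif]. *)
  pose r := (k * M - m).*2.-1.
  pose w := fun i => (0 - y i) ^+ m * ((1 - y i) ^+ r * (mu i ^+ (k.*2) * c i)).
  have Sw : S w.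
    by apply: SM (SX _ (SB S0 Sy)) (SM (SX _ S_pi) (SM (SX _ Smu) Sc)).
  have bw i : b i * (b i)^* = (1 - y i) * w i.
    have p0 : (1 - y i) ^+ m.*2 != 0 by rewrite expf_neq0.
    apply: (mulfI p0).
    have conj_pi : (1 - y i)^* = - (y i)^* * (1 - y i).
      rewrite (_ : - (y i)^* * (1 - y i) = y i * (y i)^* - (y i)^*); last by ring.
      by rewrite y_unit rmorphB rmorph1.
    have yy : (0 - y i) ^+ m * (- (y i)^*) ^+ m = 1.
      by rewrite -exprMn sub0r mulrNN y_unit expr1n.
    have -> : (1 - y i) ^+ m.*2 * (b i * (b i)^*) =
       (0 - y i) ^+ m * (x i * (x i)^*).
      rewrite bE rmorphM rmorphXn /= conj_pi exprMn -addnn exprD.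
      have -> : (0 - y i) ^+ m * ((1 - y i) ^+ m * b i *
        ((- (y i)^*) ^+ m * (1 - y i) ^+ m * (b i)^*)) =
        ((0 - y i) ^+ m * (- (y i)^*) ^+ m) * ((1 - y i) ^+ m * (1 - y i) ^+ m * (b i * (b i)^*)).
        by ring.
      by rewrite yy mul1r.
    rewrite xc /w; have -> : 4%:R ^+ k = (1 - y i) ^+ m.*2 * ((1 - y i) * (1 - y i) ^+ r) * mu i ^+ k.*2.
      rewrite -exprS -exprD.
      have -> : (m.*2 + r.+1 = M * k.*2)%N by rewrite /r; lia.
      rewrite exprM -exprMn -muE -muln2 mulnC exprM; congr (_ ^+ _); ring.
    by ring.
  have [w' Sw' w'E] := norm_dvd_unif Sb Sw bw.
  by exists w' => // i; rewrite bE w'E exprSr mulrA.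
have [b Sb bE] := descent (k * M)%N (leqnn _).
exists (fun i => nu i ^+ k * b i); first exact: SM (SX _ Snu) Sb.
move=> i; rewrite bE mulnC exprM nuE yM mulrA -exprMn; congr (_ ^+ _ * _); ring.
Qed.

End TwoAdicDescent.

(** * Characters that are -1 on the involution of a cyclic subgroup *)

Section OddCharacters.

Variables (gT : finGroupType) (Q : {group gT}) (y : gT) (s : nat).
Hypotheses (abQ : abelian Q) (Qy : y \in Q) (oy : #[y]%g = (2 ^ s.+1)%N).
Hypothesis cube : {in Q, forall g, (g ^+ 3)%g \in <[y]>%g}.

Let p : gT := (y ^+ (2 ^ s))%g.
Let X := {i : Iirr Q | 'chi_i p == -1}.
Let chi (i : X) : 'CF(Q) := 'chi_(val i).

Let lin i : 'chi[Q]_i \is a linear_char. Proof. exact/char_abelianP. Qed.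

Let chi_lin (i : X) : chi i \is a linear_char. Proof. exact: lin. Qed.

(** The image of the integral group ring of [Q] in the functions on the characters that are -1 on
    [p]. *)
Let S (x : X -> algC) := exists F : gT -> int,
  forall i, x i = \sum_(g in Q) (F g)%:~R * chi i g.

Let S_ext x z : (forall i, x i = z i) -> S x -> S z.
Proof. by move=> xz [F FE]; exists F => i; rewrite -xz. Qed.

Let S_char g : g \in Q -> S (fun i => chi i g).
Proof.
move=> Qg; exists (fun h => (h == g)%:R) => i; rewrite (bigD1 g) //= eqxx mul1r.
by rewrite big1 ?addr0 // => h /andP[_ /negPf->]; rewrite mul0r.
Qed.

Let S1 : S (fun=> 1).
Proof. by apply: S_ext (S_char (group1 Q)) => i; rewrite lin_char1. Qed.

Let SB x z : S x -> S z -> S (fun i => x i - z i).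
Proof.
case=> F FE [H HE]; exists (fun g => F g - H g) => i.
by rewrite FE HE -sumrB; apply: eq_bigr => g _; rewrite rmorphB mulrBl.
Qed.

Let SM x z : S x -> S z -> S (fun i => x i * z i).
Proof.
case=> F FE [H HE]; exists (fun t => \sum_(g in Q) F g * H (g^-1 * t)%g) => i.
under [RHS]eq_bigr => t _ do rewrite rmorph_sum mulr_suml /=.
rewrite exchange_big FE HE mulr_suml /=; apply: eq_bigr => g Qg.
rewrite mulr_sumr [RHS](reindex_inj (mulgI g)) /=.
rewrite [RHS](eq_bigl (mem Q)); last by move=> h; rewrite /= groupMl.
apply: eq_bigr => h Qh; rewrite mulKg rmorphM /= lin_charM //; ring.
Qed.

Let SC x : S x -> S (fun i => (x i)^*).
Proof.
case=> F FE; exists (fun g => F g^-1%g) => i.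
rewrite FE rmorph_sum [RHS](reindex_inj invg_inj) /=.
rewrite [RHS](eq_bigl (mem Q)); last by move=> h; rewrite /= groupV.
by apply: eq_bigr => g Qg; rewrite invgK rmorphM /= rmorph_int lin_charV_conj ?lin.
Qed.

Let S0 : S (fun=> 0).
Proof. by apply: S_ext (SB S1 S1) => i; rewrite subrr. Qed.

Let SD x z : S x -> S z -> S (fun i => x i + z i).
Proof. by move=> Sx Sz; apply: S_ext (SB Sx (SB S0 Sz)) => i; rewrite sub0r opprK. Qed.

Let yM i : chi i y ^+ (2 ^ s) = -1.
Proof. by rewrite -lin_charX //; apply/eqP: (valP i). Qed.

(** For a group element, chi(g^2) - chi(g^-1) = chi(g^-1) * (chi(g^3) - 1), and chi(g^3) is a power
    of chi(y) by [cube]. Squaring is additive modulo 2, which 1 - chi(y) divides, so the congruence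
    passes to integral combinations. *)
Let frob x : S x ->
  exists2 v, S v & forall i, (x i)^* = x i ^+ 2 + (1 - chi i y) * v i.
Proof.
pose P (x : X -> algC) :=
  S x /\ exists2 v, S v & forall i, (x i)^* = x i ^+ 2 + (1 - chi i y) * v i.
have S_geom n : S (fun i => \sum_(j < n) chi i y ^+ j).
  elim: n => [|n IHn]; first by apply: S_ext S0 => i; rewrite big_ord0.
  apply: S_ext (SD IHn (S_char (groupX n Qy))) => i.
  by rewrite big_ord_recr /= lin_charX.
have geomE n i : 1 - chi i y ^+ n = (1 - chi i y) * \sum_(j < n) chi i y ^+ j.
  by rewrite -opprB subrX1 -mulNr opprB.
have two i : 2%:R = (1 - chi i y) * \sum_(j < 2 ^ s) chi i y ^+ j :> algC.
  by rewrite -geomE yM opprK.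
have P0 : P (fun=> 0).
  by split=> //; exists (fun=> 0) => // i; rewrite rmorph0; ring.
have PD x1 x2 : P x1 -> P x2 -> P (fun i => x1 i + x2 i).
  case=> [Sx1 [v1 Sv1 E1]] [Sx2 [v2 Sv2 E2]]; split; first exact: SD.
  exists (fun i => v1 i + v2 i - (\sum_(j < 2 ^ s) chi i y ^+ j) * (x1 i * x2 i)).
    by apply: SB; [exact: SD | exact: SM (S_geom _) (SM Sx1 Sx2)].
  move=> i; rewrite rmorphD /= E1 E2.
  set G := \sum_(_ < _) _; have two_i := two i; rewrite -/G in two_i.
  rewrite (_ : (1 - chi i y) * (v1 i + v2 i - G * (x1 i * x2 i)) =
    (1 - chi i y) * (v1 i + v2 i) - ((1 - chi i y) * G) * (x1 i * x2 i)); last by ring.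
  by rewrite -two_i; ring.
have PN x1 : P x1 -> P (fun i => - x1 i).
  case=> [Sx1 [v1 Sv1 E1]]; split; first by apply: S_ext (SB S0 Sx1) => i; rewrite sub0r.
  exists (fun i => 0 - v1 i - (\sum_(j < 2 ^ s) chi i y ^+ j) * (x1 i * x1 i)).
    by apply: SB; [exact: SB | exact: SM (S_geom _) (SM Sx1 Sx1)].
  move=> i; rewrite rmorphN /= E1.
  set G := \sum_(_ < _) _; have two_i := two i; rewrite -/G in two_i.
  rewrite (_ : (1 - chi i y) * (0 - v1 i - G * (x1 i * x1 i)) =
    - (1 - chi i y) * v1 i - ((1 - chi i y) * G) * (x1 i * x1 i)); last by ring.
  by rewrite -two_i; ring.
have Pext x1 x2 : (forall i, x1 i = x2 i) -> P x1 -> P x2.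
  move=> E [Sx1 [v1 Sv1 E1]]; split; first exact: S_ext E Sx1.
  by exists v1 => // i; rewrite -E.
have Pchar g : g \in Q -> P (fun i => chi i g).
  move=> Qg; split; first exact: S_char.
  have /cycleP[n gn] := cube Qg.
  exists (fun i => chi i g^-1%g * \sum_(j < n) chi i y ^+ j).
    by apply: SM => //; apply: S_char; rewrite groupV.
  move=> i; rewrite mulrCA -geomE -!lin_charX // -gn -lin_charV_conj //.
  rewrite mulrBr mulr1 -[X in _ - X]lin_charM ?groupV ?groupX //.
  by rewrite (expgS g 2) mulKg addrC subrK.
have Pmul (n : int) x1 : P x1 -> P (fun i => n%:~R * x1 i).
  move=> Px1; have Pnat m : P (fun i => m%:R * x1 i).
    elim: m => [|m IHm]; first by apply: Pext P0 => i; rewrite mul0r.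
    by apply: Pext (PD _ _ Px1 IHm) => i; rewrite -[m.+1]add1n natrD; ring.
  case: n => m; first exact: Pnat.
  by apply: Pext (PN _ (Pnat m.+1)) => i; rewrite NegzE rmorphN mulNr.
case=> F FE; suff [] : P x by [].
have : P (fun i => \sum_(g <- enum Q) (F g)%:~R * chi i g).
  have : all [in Q] (enum Q) by apply/allP=> g; rewrite mem_enum.
  elim: (enum Q) => [|g r IHr] /= => [_|/andP[Qg Qr]].
    by apply: Pext P0 => i; rewrite big_nil.
  by apply: Pext (PD _ _ (Pmul (F g) _ (Pchar g Qg)) (IHr Qr)) => i; rewrite big_cons.
by apply: Pext => i; rewrite FE big_enum.
Qed.

(** By the descent, [F] and some 2^k * V agree on all characters that are -1 on [p].
    Antisymmetrizing the difference [E] under [p] kills the remaining characters, so by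
    orthogonality E(g) = E(g * p). *)
Lemma odd_char_dvd (F : gT -> int) (k : nat) :
  (forall i : Iirr Q, 'chi_i p = -1 ->
     (\sum_(g in Q) (F g)%:~R * 'chi_i g) * (\sum_(g in Q) (F g)%:~R * 'chi_i g)^* =
     4%:R ^+ k * 9%:R) ->
  {in Q, forall g, exists m : int, F g - F (g * p)%g = 2 ^+ k * m}.
Proof.
move=> normF.
have Qp : p \in Q by rewrite groupX.
have S9 : S (fun=> 9%:R).
  exists (fun h => 9%:R * (h == 1%g)%:R) => i; rewrite (bigD1 1%g) //= eqxx lin_char1 //.
  by rewrite big1 ?addr0 ?mulr1 // => h /andP[_ /negPf->]; rewrite mulr0 mul0r.
have SF : S (fun i => \sum_(g in Q) (F g)%:~R * chi i g) by exists F.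
have y_unit (i : X) : chi i y * (chi i y)^* = 1.
  by rewrite -lin_charV_conj // -lin_charM ?groupV // mulgV lin_char1.
have [v [V VE] FV] : exists2 v, S v & forall i : X,
    \sum_(g in Q) (F g)%:~R * chi i g = 2%:R ^+ k * v i.
  apply: (norm_dvd_pow2 S_ext S1 SB SM SC (S_char Qy) y_unit yM frob SF S9).
  by move=> i; apply: normF; apply/eqP: (valP i).
pose E g := F g - 2 ^+ k * V g.
have E_odd i : 'chi[Q]_i p = -1 -> \sum_(g in Q) (E g)%:~R * 'chi_i g = 0.
  move=> /eqP ip; have := FV (exist _ i ip); rewrite VE /chi /= => FVi.
  have -> : \sum_(g in Q) (E g)%:~R * 'chi_i g = \sum_(g in Q) (F g)%:~R * 'chi_i g -
      2%:R ^+ k * \sum_(g in Q) (V g)%:~R * 'chi_i g.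
    rewrite mulr_sumr -sumrB; apply: eq_bigr => g _.
    by rewrite /E rmorphB rmorphM rmorphXn /=; ring.
  by rewrite FVi subrr.
pose A g := E g - E (g * p)%g.
have pp : (p * p = 1)%g by rewrite -expg2 -expgM -expnSr -oy expg_order.
have A0 i : \sum_(g in Q) (A g)%:~R * 'chi[Q]_i g = 0.
  have shift : \sum_(g in Q) (E (g * p)%g)%:~R * 'chi[Q]_i g =
      'chi_i p * \sum_(g in Q) (E g)%:~R * 'chi_i g.
    rewrite mulr_sumr (reindex_inj (mulIg p)) /=.
    rewrite (eq_bigl (mem Q)); last by move=> h; rewrite /= groupMr.
    by apply: eq_bigr => g Qg; rewrite -mulgA pp mulg1 lin_charM //; ring.
  have -> : \sum_(g in Q) (A g)%:~R * 'chi[Q]_i g =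
     (1 - 'chi_i p) * \sum_(g in Q) (E g)%:~R * 'chi_i g.
    rewrite mulrBl mul1r -shift -sumrB; apply: eq_bigr => g _.
    by rewrite /A rmorphB mulrBl.
  have : 'chi_i p ^+ 2 == 1 by rewrite expr2 -lin_charM // pp lin_char1.
  rewrite sqrf_eq1 => /orP[]/eqP ip; first by rewrite ip subrr mul0r.
  by rewrite E_odd ?mulr0.
move=> g0 Qg0; exists (V g0 - V (g0 * p)%g).
suff A00 : A g0 = 0.
  by apply/eqP; rewrite -subr_eq0 -[X in _ == X]A00 /A /E; apply/eqP; ring.
have : \sum_(g in Q) (A g)%:~R * \sum_i 'chi[Q]_i g * ('chi_i g0)^* = 0.
  under eq_bigr => g _ do rewrite mulr_sumr.
  rewrite exchange_big big1 //= => i _.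
  have /(congr1 (fun c => c * ('chi_i g0)^*)) := A0 i.
  rewrite mul0r mulr_suml => Ai; rewrite -[RHS]Ai.
  by apply: eq_bigr => g _; rewrite mulrA.
rewrite (bigD1 g0) //= [X in _ + X = _]big1; last first.
  move=> g /andP[Qg ng]; rewrite second_orthogonality_relation //.
  case: imsetP => [[h Qh gE]|_]; last by rewrite mulr0.
  by rewrite gE conjgE (centsP abQ g0 Qg0 h Qh) mulKg eqxx in ng.
rewrite addr0 second_orthogonality_relation // class_refl => /eqP.
rewrite mulf_eq0 pnatr_eq0 eqn0Ngt cardG_gt0 orbF intr_eq0 => /eqP //.
Qed.

End OddCharacters.

(** * Bounding exp H through intersection numbers with cosets *)

Lemma Z33_cube (z : Z33) : (z ^+ 3 = 1)%g.
Proof.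
have /allP check : all (fun z : Z33 => z * (z * z) == 1)%g enum_Z33 by vm_compute.
by apply/eqP; rewrite !expgS expg0 mulg1; apply: check; apply: mem_enum_Z33.
Qed.

(** Otherwise every character is 1 on [p], contradicting the second orthogonality relation between 1
    and [p]. *)
Lemma odd_lin_char_exists (gT : finGroupType) (Q : {group gT}) (p : gT) :
  abelian Q -> p \in Q -> #[p]%g = 2%N -> exists i, 'chi[Q]_i p = -1.
Proof.
move=> abQ Qp op; have [/existsP[i /eqP]|/existsPn none] := boolP [exists i, 'chi[Q]_i p == -1].
  by exists i.
have p1 : p != 1%g by rewrite -order_eq1 op.
have := second_orthogonality_relation p (group1 Q).
have -> : (p \in 1 ^: Q)%g = false by rewrite class1G inE (negPf p1).
have chi1 i : 'chi[Q]_i p * ('chi_i 1%g)^* = 1.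
  have lin : 'chi_i \is a linear_char by apply/char_abelianP.
  have : 'chi_i p ^+ 2 == 1.
    by rewrite -lin_charX // -op expg_order lin_char1.
  by rewrite sqrf_eq1 (negPf (none i)) orbF => /eqP->; rewrite lin_char1 // conjC1 mulr1.
rewrite (eq_bigr (fun=> 1)) // sumr_const mulr0n => /eqP.
by rewrite pnatr_eq0 card_ord.
Qed.

Lemma HDS_exponent_bound (d : nat) (H : finGroupType) (D : {set Z33 * H}) :
  abelian [set: H] -> #|[set: H]| = (2 ^ (2 * d + 2))%N ->
  HDS (3 * 2 ^ d) D -> (exponent [set: H] <= 2 ^ (d + 2))%N.
Proof.
move=> abH cardH hds.
have [h _ expE] := exponent_witness (abelian_nil abH).
have : (#[h]%g %| 2 ^ (2 * d + 2))%N by rewrite -cardH order_dvdG ?inE.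
case/(dvdn_pfactor _ _ (isT : prime 2)) => -[|s] _ oh.
  by rewrite expE oh expn_gt0.
have /splitsP[L /complP[tiL defH]] :=
  abelian_splits (in_setT h) (esym expE) abH.
have cardL : (2 ^ s.+1 * #|L| = 2 ^ (2 * d + 2))%N.
  by rewrite -oh orderE -(TI_cardMg tiL) defH.
(* The quotient by 1 x L is Z_3^2 x <h>, and the fibre counts [n] below are at most |L|. *)
pose N : {group Z33 * H} := [group of setX [1 Z33]%g L].
have memN q : (q \in N) = (q.1 == 1%g) && (q.2 \in L) by rewrite inE /= inE.
have cardN : #|N| = #|L| by rewrite cardsX cards1 mul1n.
pose G : {group Z33 * H} := [set: Z33 * H]%G.
have abG : abelian G := Z33_comm abH.
have nNG : G \subset 'N(N)%g.
  exact: subset_trans (sub_abelian_cent abG (subsetT N)) (cent_sub _).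
have nsNG : (N <| G)%g by rewrite /normal subsetT.
have inN q : q \in 'N(N)%g by rewrite (subsetP nNG) ?inE.
pose Q := (G / N)%G; have abQ : abelian Q := quotient_abelian N abG.
pose y := coset N (1%g, h).
have Qy : y \in Q by rewrite mem_quotient ?inE.
have pairX (g : H) n : ((1%g, g) ^+ n = (1%g, g ^+ n) :> Z33 * H)%g.
  by elim: n => [|n IHn] //; rewrite !expgS IHn; congr (_, _); rewrite mul1g.
have yX n : (y ^+ n == 1)%g = (h ^+ n == 1)%g.
  rewrite -morphX //= pairX (coset_eq1E abG (subsetT N)) ?inE //.
  rewrite /= ?eqxx /=.
  apply/idP/eqP=> [Lhn|->]; last exact: group1.
  by apply/set1P; rewrite -[[set 1%g]]tiL inE mem_cycle.
have oy : #[y]%g = (2 ^ s.+1)%N.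
  by rewrite -oh; apply/eqP; rewrite eqn_dvd !order_dvdn yX expg_order eqxx -yX expg_order eqxx.
have cube : {in Q, forall g, (g ^+ 3)%g \in <[y]>%g}.
  move=> _ /morphimP[[z v] _ _ ->].
  have /mulsgP[_ l /cycleP[n ->] Ll v3] : (v ^+ 3)%g \in (<[h]> * L)%g by rewrite defH inE.
  have -> : (coset N (z, v) ^+ 3 = y ^+ n)%g.
    rewrite -!morphX //= pairX.
    have -> : ((z, v) ^+ 3 = (1, h ^+ n) * (1, l) :> Z33 * H)%g.
      have -> : ((z, v) ^+ 3 = (z ^+ 3, v ^+ 3) :> Z33 * H)%g by rewrite !expgS !expg0.
      by rewrite Z33_cube v3; congr (_, _); rewrite mulg1.
    by rewrite coset_kerr // memN eqxx.
  exact: mem_cycle.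
pose p := (y ^+ (2 ^ s))%g.
have Qp : p \in Q by rewrite groupX.
have op : #[p]%g = 2%N by rewrite orderXdiv oy ?dvdn_exp2l // expnS mulnK ?expn_gt0.
pose n c := #|[set g in D | coset N g == c]|.
have len c : (n c <= #|L|)%N.
  have [g /= /setIdP[Dg /eqP gc]|n0] := pickP [in [set g in D | coset N g == c]];
    last by rewrite /n (eq_card0 n0).
  rewrite -cardN -(card_rcoset N g); apply/subset_leq_card/subsetP => g'.
  by rewrite inE => /andP[_ /eqP g'c]; apply/rcoset_kercosetP; rewrite // gc.
have sumE i : \sum_(c in Q) ((n c)%:Z)%:~R * 'chi[Q]_i c =
    char_sum ('chi_i %% N)%CF D.
  rewrite /char_sum (partition_big (coset N) (mem Q)) /=; last first.
    by move=> g _; rewrite mem_quotient ?inE.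
  apply: eq_bigr => c _; rewrite (eq_bigr (fun=> 'chi_i c)); last first.
    by move=> g /andP[_ /eqP <-]; rewrite cfModE ?inE.
  rewrite sumr_const mulr_natl; congr (_ *+ _).
  by apply: eq_card => g; rewrite inE.
have normE (i : Iirr Q) : 'chi_i p = -1 ->
    (\sum_(c in Q) ((n c)%:Z)%:~R * 'chi_i c) *
    (\sum_(c in Q) ((n c)%:Z)%:~R * 'chi_i c)^* = 4%:R ^+ d * 9%:R.
  move=> ip; rewrite sumE (HDS_char_norm hds).
  - have -> : ((3 * 2 ^ d) ^ 2 = 4 ^ d * 9)%N.
      by rewrite expnMn -[in LHS]expnM (mulnC d 2) expnM mulnC.
    by rewrite natrM natrX.
  - by rewrite cfMod_lin_char //; apply/char_abelianP.
  apply: contra_eqN ip => /eqP chi1; rewrite -[p]/(y ^+ (2 ^ s))%g.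
  have := congr1 (fun f : 'CF(G) => f (1, h ^+ (2 ^ s))%g) chi1.
  rewrite cfModE ?inE // cfun1E inE -pairX morphX //= => ->.
  by rewrite -subr_eq0 opprK -mulr2n pnatr_eq0.
have dvd := odd_char_dvd abQ Qy oy cube normE.
have [i ip] := odd_lin_char_exists abQ Qp op.
(* If [n] were invariant under [p], its sum against a character that is -1 on [p] would vanish,
   contrary to [normE]. *)
have [c Qc nc] : exists2 c, c \in Q & n c != n (c * p)%g.
  have [/existsP[c /andP[]]|/existsPn none] := boolP [exists c, (c \in Q) && (n c != n (c * p)%g)].
    by exists c.
  set sn := \sum_(c in Q) ((n c)%:Z)%:~R * 'chi_i c.
  have sn0 : sn = - sn.
    rewrite {1}/sn (reindex_inj (mulIg p)) /= -mulN1r mulr_sumr.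
    rewrite (eq_bigl (mem Q)); last by move=> c; rewrite /= groupMr.
    apply: eq_bigr => c; rewrite -[mem Q c]/(c \in Q) => Qc.
    rewrite lin_charM //; last exact/char_abelianP.
    by have := none c; rewrite Qc negbK => /eqP <-; rewrite ip; ring.
  have := normE i ip; rewrite -/sn.
  have -> : sn = 0.
    have /eqP : sn *+ 2 = 0 by rewrite mulr2n {1}sn0 addNr.
    by rewrite mulrn_eq0 => /eqP.
  rewrite mul0r => /esym/eqP; rewrite mulf_eq0 expf_eq0 !pnatr_eq0 andbF //.
have [m mE] := dvd c Qc.
have le2L : (2 ^ d <= #|L|)%N.
  have m0 : m != 0.
    by apply: contra nc => /eqP m0; move: mE; rewrite m0 mulr0 => /eqP; rewrite subr_eq0.
  have : (2 ^ d <= `|(n c)%:Z - (n (c * p)%g)%:Z|)%N.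
    by rewrite mE abszM abszX leq_pmulr // absz_gt0.
  have := len c; have := len (c * p)%g.
  move: (n c) (n (c * p)%g) (2 ^ d)%N #|L| => n1 n2 P l; clear; lia.
(* From 2^d <= |L| and 2^(s+1) * |L| = 2^(2d+2) follows s + 1 <= d + 2. *)
rewrite expE oh leq_exp2l // -(leq_add2r d) -(@leq_exp2l 2) // expnD.
rewrite addnAC addnn -mul2n.
by rewrite -cardL leq_pmul2l ?expn_gt0.
Qed.


Local Close Scope ring_scope.
Theorem theorem1p1 (d : nat) (hd : 1 <= d) (H : finGroupType)
    (abH : abelian [set: H]) (twoH : (2.-group [set: H])%g)
    (cardH : #|[set: H]| = 2 ^ (2 * d + 2)) :
  (exists D : {set ('Z_3 * 'Z_3 * H)%type}, non_naive_HDS (3 * 2 ^ d) D) <->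
  (8 <= exponent [set: H] <= 2 ^ (d + 2)).
Proof.
split=> [[D [hds not_naive]]|]; last exact: non_naive_HDS_exists.
rewrite (HDS_exponent_bound abH cardH hds) andbT leqNgt.
apply/negP => lt8; apply: not_naive; split=> // chi chi_lin nchi1.
have [omega omega_eq omega_conj] := cube_root_exists.
(* A 2-power exponent below 8 divides 4, so every element of the group is killed by 12 and all
   character values are twelfth roots of unity. *)
apply: (twelfth_root_sum_naive omega_eq omega_conj); last exact: HDS_char_norm.
move=> [z v]; rewrite -lin_charX ?inE //.
suff -> : ((z, v) ^+ 12 = 1)%g by rewrite lin_char1.
have -> : ((z, v) ^+ 12 = (z ^+ 12, v ^+ 12) :> Z33 * H)%g.
  by elim: 12%N => [|n IHn] //; rewrite !expgS IHn.
have [y _ expE] := exponent_witness (abelian_nil abH).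
have : #[y]%g %| 2 ^ (2 * d + 2) by rewrite -cardH order_dvdG ?inE.
case/(dvdn_pfactor _ _ (isT : prime 2)) => a _ oy.
have dvd4 : exponent [set: H] %| 4.
  rewrite expE oy (@dvdn_exp2l 2 a 2) // -ltnS -(@ltn_exp2l 2) //.
  by rewrite -oy -expE.
have v4 : (v ^+ 4 = 1)%g.
  by apply/eqP; rewrite -order_dvdn (dvdn_trans (dvdn_exponent (in_setT v))).
by rewrite (expgM z 3 4) (expgM v 4 3) Z33_cube v4 !expg1n.
Qed.
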